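(* If there is an abelian group of cardinality $\aleph_1$ which is hereditarily separable and not free, then there is a ladder system on a stationary subset of $\omega_1$ which satisfies monochromatic uniformization for $\omega$ colours.
   Context: A group $G$ is separable if every finite rank pure subgroup of $G$ is a free direct summand of $G$; $G$ is hereditarily separable if every subgroup of $G$ is separable. For $S\subseteq\lim(\omega_1)$, a ladder on $\delta\in S$ is a strictly increasing $\eta_\delta\colon\omega\to\delta$ with range cofinal in $\delta$; a ladder system on $S$ is a family $\eta=\{\eta_\delta:\delta\in S\}$ of ladders. $\eta$ satisfies monochromatic uniformization for $\omega$ colours if for every $c\colon S\to\omega$ there are $f\colon\omega_1\to\omega$ and $f^*\colon S\to\omega$ with $f(\eta_\delta(n))=c(\delta)$ for all $\delta\in S$ and $n\ge f^*(\delta)$. *)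

(* Defs.v *)
From HB Require Import structures.
From mathcomp Require Import all_boot all_order all_algebra.
From mathcomp Require Import boolp classical_sets functions cardinality wochoice.

Set Implicit Arguments.
Unset Strict Implicit.
Unset Printing Implicit Defensive.

Import Order.TTheory GRing.Theory.
Local Open Scope classical_set_scope.
Local Open Scope ring_scope.

Section AbelianGroups.
Variable G : zmodType.

(* Integer coefficients are given by a total function on G, of which only the
   values on the list s matter. *)
Definition lin_indep (B : {pred G}) :=
  forall (s : seq G) (a : G -> int), uniq s -> {subset s <= B} ->
    \sum_(x <- s) x *~ a x = 0 -> {in s, forall x, a x = 0}.

Definition in_span (B : {pred G}) (y : G) :=
  exists (s : seq G) (a : G -> int),
    {subset s <= B} /\ y = \sum_(x <- s) x *~ a x.

Definition free_abelian (A : {pred G}) :=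
  exists B : {pred G},
    [/\ {subset B <= A}, lin_indep B & {in A, forall y, in_span B y}].

(* Torsion-free rank: the size of a maximal Z-independent subset. *)
Definition finite_rank (A : {pred G}) :=
  exists n : nat, forall s : seq G,
    uniq s -> {subset s <= A} -> lin_indep (mem s) -> (size s <= n)%N.

(* Subgroups of G are the elements of zmodClosed G. The notions below are
   relative to an ambient subgroup A, so that they apply to A as a group in its
   own right. *)
Definition pure_in (A H : zmodClosed G) :=
  {subset H <= A} /\
  forall n : nat, {in A, forall g, g *+ n \in H ->
    exists2 h, h \in H & h *+ n = g *+ n}.

Definition direct_summand (A H : zmodClosed G) :=
  {subset H <= A} /\
  exists C : zmodClosed G,
    [/\ {subset C <= A},
        {in A, forall g, exists h c, [/\ h \in H, c \in C & g = h + c]}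
      & forall x, x \in H -> x \in C -> x = 0].

Definition separable (A : zmodClosed G) :=
  forall H : zmodClosed G, pure_in A H -> finite_rank H ->
    free_abelian H /\ direct_summand A H.

Definition hereditarily_separable := forall A : zmodClosed G, separable A.

End AbelianGroups.

(* omega1 is carved out of a well-ordering of the power set of nat, as the
   initial segment of the elements with countably many predecessors. The lemmas
   below give its defining properties: it is a well-order, it is uncountable,
   and all its proper initial segments are countable. *)
Definition wo_le : rel (set nat) := sval (well_ordering_principle (set nat)).

Lemma wo_leP : well_order wo_le.
Proof. exact: svalP (well_ordering_principle (set nat)). Qed.

Record omega1 : Type := Omega1 {
  omega1_val : set nat;
  omega1_valP : `[< countable [set y | wo_le y omega1_val] >]
}.

HB.instance Definition _ := [isSub for omega1_val].
HB.instance Definition _ := [Choice of omega1 by <:].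

Definition omega1_le (x y : omega1) : bool := wo_le (val x) (val y).

Local Lemma wo_chainT : wo_chain wo_le predT.
Proof. by move=> A _; exact: wo_leP. Qed.

Lemma omega1_le_refl : reflexive omega1_le.
Proof. by move=> x; exact: (wo_chain_reflexive wo_chainT). Qed.

Lemma omega1_le_anti : antisymmetric omega1_le.
Proof.
by move=> x y xy; apply: val_inj; exact: (wo_chain_antisymmetric wo_chainT).
Qed.

Lemma omega1_le_total : total omega1_le.
Proof. by move=> x y; exact: (wo_chainW wo_chainT). Qed.

Lemma wo_le_trans : transitive wo_le.
Proof.
move=> y x z xy yz.
have [|m [[mA lm] _]] := wo_leP (A := [pred t | t \in [:: x; y; z]]).
  by exists x; rewrite !inE eqxx.
have [mx my mz] : [/\ wo_le m x, wo_le m y & wo_le m z].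
  by split; apply: lm; rewrite !inE eqxx ?orbT.
have anti u v : wo_le u v -> wo_le v u -> u = v.
  by move=> uv vu; apply: (wo_chain_antisymmetric wo_chainT) => //; rewrite uv.
move: mA; rewrite !inE => /or3P[] /eqP E; rewrite {m}E in lm mx my mz.
- by [].
- by rewrite (anti _ _ xy mx).
- by rewrite -(anti _ _ yz my).
Qed.

Lemma omega1_le_trans : transitive omega1_le.
Proof. by move=> y x z; exact: wo_le_trans. Qed.

Fact omega1_display : Order.disp_t. Proof. exact: Order.Disp tt tt. Qed.

HB.instance Definition _ := Order.Le_isPOrder.Build omega1_display omega1
  omega1_le_refl omega1_le_anti omega1_le_trans.
HB.instance Definition _ :=
  Order.POrder_isTotal.Build omega1_display omega1 omega1_le_total.

Lemma omega1_well_ordered (A : set omega1) :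
  A !=set0 -> exists2 x, A x & forall y, A y -> (x <= y)%O.
Proof.
move=> [x0 Ax0].
have [|m [[/asboolP[m' Am' <-] lm] _]] := wo_leP (A := [pred t | `[< (val @` A) t >]]).
  by exists (val x0); apply/asboolP; exists x0.
by exists m' => // y Ay; apply: lm; apply/asboolP; exists y.
Qed.

Lemma omega1_initial_countable (x : omega1) : countable [set y | (y < x)%O].
Proof.
have /asboolP/countable_injP[f f_inj] := valP x.
apply/countable_injP; exists (f \o omega1_val) => y z; rewrite !inE /= => yx zx fyz.
by apply/val_inj/f_inj => //; rewrite inE; [exact: (ltW yx)|exact: (ltW zx)].
Qed.

Lemma omega1_uncountable : ~ countable [set: omega1].
Proof.
move=> /countable_injP[f f_inj].
pose W : set (set nat) := [set x | countable [set y | wo_le y x]].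
have Wc : countable W.
  apply/countable_injP.
  exists (fun x => if pselect (W x) is left Wx
    then f (Omega1 (introT (asboolP _) Wx)) else 0%N) => x y.
  rewrite !inE => Wx Wy; case: pselect => // {}Wx; case: pselect => // {}Wy fxy.
  exact: (congr1 omega1_val (f_inj _ _ (in_setT _) (in_setT _) fxy)).
have WT x : W x.
  apply: contrapT => nWx.
  have [|m [[/asboolP nWm lm] _]] :=
    wo_leP (A := [pred t | `[< ~ W t >]]).
    by exists x; apply/asboolP.
  apply: nWm; rewrite /W /=.
  apply: (sub_countable (B := W `|` [set m])).
    apply: subset_card_le => y /= ym; have [|nWy] := pselect (W y); first by left.
    right; apply: (wo_chain_antisymmetric wo_chainT) => //.
    by rewrite ym lm //; apply/asboolP.
  have /countable_injP[g g_inj] := Wc.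
  apply/countable_injP.
  exists (fun y => if pselect (W y) is left _ then (g y).+1 else 0%N) => y z.
  rewrite !inE => Wy Wz.
  case: pselect => y1; case: pselect => z1 //.
    by move=> [/g_inj]; apply; rewrite inE.
  by case: Wy Wz => // -> [] // ->.
have /countable_injP[g g_inj] := Wc.
pose D : set nat := [set n | exists A : set nat, g A = n /\ ~ A n].
have [DgD|nD] := pselect (D (g D)).
  have [A [/g_inj gA nA]] := DgD.
  by apply: nA; rewrite gA ?inE.
by apply: (nD); exists D.
Qed.

Section Ladders.
Implicit Types (S C : set omega1) (d : omega1).

(* The least element is not a limit ordinal. *)
Definition limit d :=
  (exists a, (a < d)%O) /\ forall a, (a < d)%O -> exists b, (a < b < d)%O.

Definition club C :=
  (forall d, limit d ->
     (forall a, (a < d)%O -> exists2 b, C b & (a < b < d)%O) -> C d) /\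
  (forall a, exists2 b, C b & (a < b)%O).

Definition stationary S := forall C, club C -> S `&` C !=set0.

Definition ladder d (e : nat -> omega1) :=
  [/\ forall n, (e n < d)%O,
      forall m n, (m < n)%N -> (e m < e n)%O
    & forall a, (a < d)%O -> exists n, (a <= e n)%O].

(* A family indexed by S is given by a total function on omega1, of which only
   the values on S matter; likewise for c and fstar below. *)
Definition ladder_system S (eta : omega1 -> nat -> omega1) :=
  S `<=` limit /\ forall d, S d -> ladder d (eta d).

Definition monochromatic_uniformization S (eta : omega1 -> nat -> omega1) :=
  forall c : omega1 -> nat, exists f fstar : omega1 -> nat,
    forall d n, S d -> (fstar d <= n)%N -> f (eta d n) = c d.

End Ladders.

(* Main.v *)
From HB Require Import structures.
Require Import Defs.
From mathcomp Require Import all_boot all_order all_algebra.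
From mathcomp Require Import boolp classical_sets functions cardinality.
From mathcomp Require Import ring.

(* Write Z[1/q] for the rationals whose denominator is a power of q. Filter G by
   the countable sets H_d, d < omega1, which are pure subgroups for d in a club.
   Call H_d q-unseparated if some z outside H_d lies in a finite rank extension E
   of H_d such that every homomorphism E -> Z[1/q] vanishing on H_d kills z.
   Where H_d is neither 2- nor 3-unseparated, the denominators of coordinates in
   a finite rank extension are bounded, because Z[1/2] and Z[1/3] meet in Z; so
   finite rank quotients over H_d are finitely generated, and Pontryagin's
   criterion applies. If this holds on a club then G is free. Hence for q = 2 or
   q = 3 the set S of q-unseparated d is stationary.

   Given colours c, extend z_d |-> q^(-c d), b |-> 0 (where b generates a direct
   summand of G) to a homomorphism from G to the divisible group Z[1/q] / qZ.
   Separability of the subgroup of those x on which this homomorphism agrees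
   modulo q with the coordinate of x along b turns it into a homomorphism
   h : G -> Z[1/q] such that h z_d has q-adic valuation - c d.

   Finally, h z_d is determined by h on H_d, and even by a search: among all
   tuples of candidate values of h at the generators of E, the first one that is
   consistent with n divisibility relations over H_d stabilises as n grows, at a
   tuple giving the right value to z_d. The ladder at d codes longer and longer
   finite lists of such relations, and f reads off the colour. *)

Set Implicit Arguments.
Unset Strict Implicit.
Unset Printing Implicit Defensive.
Import Order.TTheory GRing.Theory Num.Theory.
Local Open Scope classical_set_scope.
Local Open Scope ring_scope.

(** * The order type omega1 *)

Lemma countable_image T U (f : T -> U) (X : set T) : countable X -> countable (f @` X).
Proof. exact: sub_countable (card_image_le _ _). Qed.

Lemma countable_setU T (X Y : set T) :
  countable X -> countable Y -> countable (X `|` Y).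
Proof.
move=> cX cY; rewrite (_ : X `|` Y = \bigcup_(b in [set: bool]) if b then X else Y).
  by apply: bigcup_countable => // -[].
apply/seteqP; split=> [x [Xx|Yx]|x [[] _]]; [by exists true|by exists false|by left|by right].
Qed.

Lemma countable_lt_bounded (X : set omega1) :
  countable X -> exists b, forall x, X x -> (x < b)%O.
Proof.
move=> cX; apply: contrapT => /forallNP nb; apply: omega1_uncountable.
suff E : [set: omega1] `<=` \bigcup_(x in X) ([set y | (y < x)%O] `|` [set x]).
  apply: sub_countable (subset_card_le E) _.
  apply: bigcup_countable => // x _.
  exact: countable_setU (omega1_initial_countable _) (countable1 _).
move=> y _; have /existsNP[x /not_implyP[Xx /negP]] := nb y.
rewrite -leNgt le_eqVlt => /orP[/eqP yx|yx]; exists x => //; first by right.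
by left.
Qed.

Lemma omega1_lub (X : set omega1) (b : omega1) :
  (forall x, X x -> (x <= b)%O) ->
  exists2 l, (forall x, X x -> (x <= l)%O) &
    forall a, (forall x, X x -> (x <= a)%O) -> (l <= a)%O.
Proof.
by move=> Xb; have [|l] :=
  @omega1_well_ordered [set a | forall x, X x -> (x <= a)%O]; [exists b|exists l].
Qed.

Lemma osuccP (a : omega1) : exists s, (a < s)%O /\ forall b, (a < b)%O -> (s <= b)%O.
Proof.
have [b ab] := countable_lt_bounded (countable1 a).
have [|s as_ ls] := @omega1_well_ordered [set x | (a < x)%O].
  by exists b; apply: ab.
by exists s.
Qed.

Definition osucc a := sval (cid (osuccP a)).

Lemma lt_osucc a : (a < osucc a)%O.
Proof. by rewrite /osucc; case: cid => s []. Qed.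

Lemma osucc_le a b : (a < b)%O -> (osucc a <= b)%O.
Proof. by rewrite /osucc; case: cid => s [_] /=; exact. Qed.

Lemma osucc_inj : injective osucc.
Proof.
move=> a b ab; case: (ltgtP a b) => // /osucc_le; first by rewrite ab leNgt lt_osucc.
by rewrite -ab leNgt lt_osucc.
Qed.

Lemma limit_osucc d a : limit d -> (a < d)%O -> (osucc a < d)%O.
Proof.
move=> [_ ld] /ld[b /andP[ab bd]]; exact: le_lt_trans (osucc_le ab) bd.
Qed.

Lemma osucc_not_limit a : ~ limit (osucc a).
Proof. by move=> /limit_osucc/(_ (lt_osucc a)); rewrite ltxx. Qed.

Lemma limit_iter_osucc d a n : limit d -> (a < d)%O -> (iter n osucc a < d)%O.
Proof. by move=> ld ad; elim: n => //= n; apply: limit_osucc. Qed.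

(** Lets an ordinal of the form limit plus [n] code the pair of its two parts, as [unbounded_coding]
    requires. *)
Lemma limit_iter_osucc_inj a b m n : limit a -> limit b ->
  iter m osucc a = iter n osucc b -> a = b /\ m = n.
Proof.
move=> la lb; elim: m n => [|m IH] [|n] //=.
- by move=> E; case: (@osucc_not_limit (iter n osucc b)); rewrite -E.
- by move=> E; case: (@osucc_not_limit (iter m osucc a)); rewrite E.
- by move=> /osucc_inj/IH[-> ->].
Qed.

(** A convenient base of the club filter: these sets are closed and unbounded, and every club
    contains one of them. *)
Definition closed_points (F : omega1 -> omega1) : set omega1 :=
  [set d | limit d /\ forall a, (a < d)%O -> (F a < d)%O].

Lemma closed_points_above F a : exists2 d, closed_points F d & (a < d)%O.
Proof.
(* [y] bounds [x] and the values of [F] on the countable segment up to [x]. The supremum of the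
   iterates of such a choice is closed under [F]. *)
have nextP x : exists y, (x < y)%O /\ forall u, (u <= x)%O -> (F u < y)%O.
  have cX : countable ([set x] `|` F @` [set u | (u < osucc x)%O]).
    exact: countable_setU (countable1 _) (countable_image _ (omega1_initial_countable _)).
  have [y yP] := countable_lt_bounded cX.
  exists y; split=> [|u ux]; apply: yP; first by left.
  by right; exists u => //=; apply: le_lt_trans ux (lt_osucc x).
have [nxt nxtP] := choice nextP.
pose u n := iter n nxt a.
have uS n : (u n < u n.+1)%O by rewrite /u /=; case: (nxtP (u n)).
have cu : countable (range u) by exact: countable_image.
have [B uB] := countable_lt_bounded cu.
have [|l ul lmin] := @omega1_lub (range u) B.
  by move=> x /uB/ltW.
have ult n : (u n < l)%O by apply: lt_le_trans (uS n) _; apply: ul; exists n.+1.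
have cof x : (x < l)%O -> exists n, (x < u n)%O.
  move=> xl; apply: contrapT => /forallNP nx.
  suff /lmin : forall y, range u y -> (y <= x)%O by rewrite leNgt xl.
  by move=> _ [n _ <-]; rewrite leNgt; apply/negP/nx.
exists l; last exact: (ult 0%N).
split; [split|] => [|x /cof[n xn]|x /cof[n xn]].
- by exists a; exact: (ult 0%N).
- by exists (u n); rewrite xn ult.
- have [_ /(_ x (ltW xn)) Fx] := nxtP (u n).
  exact: lt_trans Fx (ult n.+1).
Qed.

Lemma closed_points_lim F d : limit d ->
  (forall a, (a < d)%O -> exists2 b, closed_points F b & (a < b < d)%O) ->
  closed_points F d.
Proof.
move=> ld cof; split=> // a /cof[b [_ Fb] /andP[ab bd]].
exact: lt_trans (Fb _ ab) bd.
Qed.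

Lemma stationary_closed_points S :
  (forall F, exists2 d, S d & closed_points F d) -> stationary S.
Proof.
move=> SF C [Cl Cu].
have [F FP] := choice (fun a => (let: ex_intro2 b Cb ab := Cu a in
  ex_intro (fun b => C b /\ (a < b)%O) b (conj Cb ab))).
have [d Sd [ld Fd]] := SF F.
(* [F] picks points of [C], so a limit closed under [F] is a limit of points of [C]. *)
exists d; split=> //; apply: Cl => // a ad; have [CF aF] := FP a.
by exists (F a) => //; rewrite aF Fd.
Qed.

Lemma not_stationary_closed_points S :
  ~ stationary S -> exists F, forall d, S d -> ~ closed_points F d.
Proof.
move=> nS; apply: contrapT => /forallNP nF; apply: nS.
apply: stationary_closed_points => F.
have /existsNP[d /not_implyP[Sd /contrapT Fd]] := nF F.
by exists d.
Qed.

(** * Subgroups and values of homomorphisms into Z[1/q] *)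

(** The generator is the least positive element, or 0 if there is none; division with remainder does
    the rest. *)
Lemma int_subgroup_principal (I : set int) :
  I 0 -> (forall i j, I i -> I j -> I (i - j)) ->
  exists2 n, I n & forall i, I i -> exists k, i = k * n.
Proof.
move=> I0 IB.
have IN i : I i -> I (- i) by move=> Ii; rewrite -sub0r; exact: IB.
have ID i j : I i -> I j -> I (i + j).
  by move=> Ii Ij; rewrite -[j]opprK; apply: IB => //; exact: IN.
have IM k i : I i -> I (k * i).
  move=> Ii; elim/int_ind: k => [|n IHn|n IHn]; first by rewrite mul0r.
    by rewrite -add1n PoszD mulrDl mul1r; exact: ID.
  by rewrite -add1n PoszD opprD mulrDl mulN1r; apply: ID => //; exact: IN.
have [[m [m0 Im]]|noI] := pselect (exists m : nat, (0 < m)%N /\ I m%:Z); last first.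
  exists 0 => // i Ii; exists 0; rewrite mulr0; apply: contrapT => /eqP i0.
  apply: noI; exists `|i|%N; rewrite absz_gt0; split=> //.
  by case: i Ii {i0} => n Ii //; rewrite NegzE in Ii; rewrite /= -[Posz _]opprK; exact: IN.
have exP : exists m : nat, `[< (0 < m)%N /\ I m%:Z >] by exists m; apply/asboolP.
case: (ex_minnP exP) => n /asboolP[n0 In] nmin.
exists n%:Z => // i Ii; exists (i %/ n%:Z)%Z.
have nz : n%:Z != 0 by rewrite eqz_nat -lt0n.
have r0 := modz_ge0 i nz; have rlt := ltz_mod i nz.
have Ir : I (i %% n%:Z)%Z by rewrite /modz; apply: IB => //; exact: IM.
move: (i %% n%:Z)%Z (divz_eq i n%:Z) r0 rlt Ir => [] // [|r] E _ rlt Ir; first by rewrite {1}E addr0.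
have : (n <= r.+1)%N by apply: nmin; apply/asboolP.
by move: rlt; rewrite ltz_nat ltnNge => /negbTE->.
Qed.

Definition Zloc (q : nat) : set rat :=
  [set u | exists k (n : int), u * q%:R ^+ k = n%:~R].

Lemma Zloc_int q (n : int) : Zloc q n%:~R.
Proof. by exists 0%N, n; rewrite expr0 mulr1. Qed.

Lemma ZlocM q u v : Zloc q u -> Zloc q v -> Zloc q (u * v).
Proof.
move=> [k [m E]] [l [n E']]; exists (k + l)%N, (m * n).
by rewrite exprD mulrACA E E' intrM.
Qed.

Lemma ZlocN q u : Zloc q u -> Zloc q (- u).
Proof. by move=> [k [m E]]; exists k, (- m); rewrite mulNr E rmorphN. Qed.

Lemma ZlocD q u v : Zloc q u -> Zloc q v -> Zloc q (u + v).
Proof.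
move=> [k [m E]] [l [n E']]; exists (k + l)%N, (m * q%:Z ^+ l + n * q%:Z ^+ k).
rewrite rmorphD /= !rmorphM /= !rmorphXn /= -E -E' exprD -!pmulrn.
by ring.
Qed.

Lemma ZlocB q u v : Zloc q u -> Zloc q v -> Zloc q (u - v).
Proof. by move=> ? ?; apply/ZlocD => //; exact: ZlocN. Qed.

Lemma Zloc_sum q (I : Type) (s : seq I) (P : pred I) (F : I -> rat) :
  (forall i, P i -> Zloc q (F i)) -> Zloc q (\sum_(i <- s | P i) F i).
Proof.
move=> PF; elim/big_rec: _ => [|i x Pi]; first exact: (Zloc_int q 0).
by move=> Zx; apply: ZlocD => //; exact: PF.
Qed.

(** By Bezout for [p^k] and [q^l], [u] is an integer combination of the two integers [u * p^k] and
    [u * q^l]. *)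
Lemma Zloc_coprime p q u : coprime p q -> Zloc p u -> Zloc q u ->
  exists n : int, u = n%:~R.
Proof.
move=> pq [k [m E]] [l [n E']].
have /coprimezP[[a b] /= ab] : coprimez (p%:Z ^+ k) (q%:Z ^+ l).
  by rewrite coprimezE !abszX !absz_nat; exact: coprimeXl (coprimeXr _ pq).
exists (a * m + b * n).
rewrite rmorphD /= !rmorphM /= -E -E'.
move/(congr1 (intr : int -> rat)): ab.
rewrite rmorphD rmorph1 /= !rmorphM /= !rmorphXn /= -!pmulrn => ab.
by transitivity (u * 1); [rewrite mulr1 | rewrite -[in LHS]ab; ring].
Qed.

Section Subgroups.
Variable G : zmodType.
Implicit Types (H K B : set G) (x y : G) (e : nat -> G) (c : nat -> int) (v : nat -> rat).

Definition subgroup H := H 0 /\ forall x y, H x -> H y -> H (x - y).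
Definition pure_subgroup H :=
  subgroup H /\ forall m x, (0 < m)%N -> H (x *+ m) -> H x.

Section SubgroupTheory.
Variables (H : set G) (sH : subgroup H).

Lemma subgroupB x y : H x -> H y -> H (x - y).
Proof. by case: sH => _; exact. Qed.

Lemma subgroupN x : H x -> H (- x).
Proof. by move=> Hx; rewrite -sub0r; apply: subgroupB => //; case: sH. Qed.

Lemma subgroupD x y : H x -> H y -> H (x + y).
Proof. by move=> Hx Hy; rewrite -[y]opprK; apply: subgroupB => //; exact: subgroupN. Qed.

Lemma subgroupMn x n : H x -> H (x *+ n).
Proof.
by move=> Hx; elim: n => [|n IH]; rewrite ?mulrS; [case: sH|exact: subgroupD].
Qed.

Lemma subgroupMz x (n : int) : H x -> H (x *~ n).
Proof.
by case: n => n Hx; rewrite ?NegzE ?mulrNz; [|apply: subgroupN]; exact: subgroupMn.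
Qed.

Lemma subgroup_sum (I : Type) (s : seq I) (P : pred I) (F : I -> G) :
  (forall i, P i -> H (F i)) -> H (\sum_(i <- s | P i) F i).
Proof.
move=> PF; elim/big_rec: _ => [|i x Pi]; first by case: sH.
by move=> Hx; apply: subgroupD => //; exact: PF.
Qed.

Lemma subgroup_sum_seq (s : seq G) (F : G -> G) :
  (forall x, x \in s -> H (F x)) -> H (\sum_(x <- s) F x).
Proof. by move=> sF; rewrite big_seq; exact: subgroup_sum. Qed.

End SubgroupTheory.

Lemma pure_subgroupMz H x (n : int) : pure_subgroup H -> n != 0 -> H (x *~ n) -> H x.
Proof.
move=> [sH pH]; case: n => n n0 Hx; first by apply: (pH n) => //; rewrite lt0n.
apply: (pH n.+1) => //; rewrite -[_ *+ _]opprK; exact: subgroupN.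
Qed.

(** Families are indexed by all of [nat] and only the first [r] entries count, so that the number of
    generators can vary without a change of type. *)
Definition lc e r c : G := \sum_(i < r) e i *~ c i.
Definition dot r c v : rat := \sum_(i < r) (c i)%:~R * v i.

Lemma lcB e r c1 c2 : lc e r (fun i => c1 i - c2 i) = lc e r c1 - lc e r c2.
Proof. by rewrite /lc -sumrB; apply: eq_bigr => i _; rewrite mulrzBr. Qed.

Lemma lcM e r c (k : int) : lc e r (fun i => c i * k) = lc e r c *~ k.
Proof. by rewrite /lc mulrz_suml; apply: eq_bigr => i _; rewrite mulrzA. Qed.

Lemma lc0 e r : lc e r (fun=> 0) = 0.
Proof. by rewrite /lc big1. Qed.

Lemma lc_delta e r j : (j < r)%N -> lc e r (fun i => (i == j)%:Z) = e j.
Proof.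
move=> jr; rewrite /lc (bigD1 (Ordinal jr)) //= eqxx mulr1z big1 ?addr0 // => i.
by rewrite -val_eqE /= => /negbTE->.
Qed.

Lemma dot_delta r j v : (j < r)%N -> dot r (fun i => (i == j)%:Z) v = v j.
Proof.
move=> jr; rewrite /dot (bigD1 (Ordinal jr)) //= eqxx mul1r big1 ?addr0 // => i.
by rewrite -val_eqE /= => /negbTE->; rewrite mul0r.
Qed.

Lemma dotBl r c1 c2 v : dot r (fun i => c1 i - c2 i) v = dot r c1 v - dot r c2 v.
Proof. by rewrite /dot -sumrB; apply: eq_bigr => i _; rewrite rmorphB mulrBl. Qed.

Lemma dotMl r c v (k : int) : dot r (fun i => c i * k) v = k%:~R * dot r c v.
Proof. by rewrite /dot mulr_sumr; apply: eq_bigr => i _; rewrite rmorphM /=; ring. Qed.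

Lemma dotBr r c v1 v2 : dot r c (fun i => v1 i - v2 i) = dot r c v1 - dot r c v2.
Proof. by rewrite /dot -sumrB; apply: eq_bigr => i _; rewrite mulrBr. Qed.

Lemma dotMr r c v (t : rat) : dot r c (fun i => t * v i) = t * dot r c v.
Proof. by rewrite /dot mulr_sumr; apply: eq_bigr => i _; rewrite mulrCA. Qed.

(* v is the tuple of values at e of a homomorphism into Z[1/q] that is defined
   on the purification of H + <e_0, ..., e_(r-1)> and vanishes on H. *)
Definition hom_values q H e r v :=
  (forall i, Zloc q (v i)) /\
  forall m x c, (0 < m)%N -> H (x *+ m - lc e r c) -> Zloc q (dot r c v / m%:R).

Definition unseparated q H := exists e r c,
  ~ H (lc e r c) /\ forall v, hom_values q H e r v -> dot r c v = 0.

Lemma hom_valuesB q H e r v1 v2 (s t : rat) : Zloc q s -> Zloc q t ->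
  hom_values q H e r v1 -> hom_values q H e r v2 ->
  hom_values q H e r (fun i => s * v1 i - t * v2 i).
Proof.
move=> Zs Zt [Z1 h1] [Z2 h2]; split=> [i|m x c m0 Hx].
  by apply: ZlocB; exact: ZlocM.
rewrite dotBr !dotMr mulrBl -!mulrA.
by apply: ZlocB; apply: ZlocM => //; [exact: h1 Hx|exact: h2 Hx].
Qed.

Lemma hom_values_dot q H e r v c : hom_values q H e r v -> Zloc q (dot r c v).
Proof.
by move=> [Zv _]; apply: Zloc_sum => i _; apply: ZlocM => //; exact: Zloc_int.
Qed.

(** Linear algebra by induction on [n]: a tuple [v] that kills the earlier vectors but not [cs n] is
    corrected by a second tuple [w], so that [cs n] is killed as well and [c] still is not. *)
Lemma separating_values q H e r (cs : nat -> nat -> int) n c :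
  ~ unseparated q H ->
  (forall (m : int) (ms : nat -> int), m != 0 ->
     ~ H (lc e r c *~ m - \sum_(i < n) lc e r (cs i) *~ ms i)) ->
  exists v, [/\ hom_values q H e r v, forall i, (i < n)%N -> dot r (cs i) v = 0
              & dot r c v != 0].
Proof.
move=> nb; elim: n c => [|n IH] c ind.
  apply: contrapT => nex; apply: nb; exists e, r, c; split.
    by have := ind 1 (fun=> 0) isT; rewrite big_ord0 subr0 mulr1z.
  by move=> v hv; apply: contrapT => /eqP dv; apply: nex; exists v.
have [|v [hv v0 vc]] := IH c.
  move=> m ms m0; have := ind m (fun i => if (i < n)%N then ms i else 0) m0.
  rewrite big_ord_recr /= ltnn mulr0z addr0.
  by under eq_bigr => i _ do rewrite ltn_ord.
have [vn|vn] := eqVneq (dot r (cs n) v) 0.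
  by exists v; split=> // i; rewrite ltnS leq_eqVlt => /orP[/eqP->//|]; exact: v0.
set s := dot r (cs n) v in vn *; set t := dot r c v in vc *.
pose al := numq s * denq t; pose be := numq t * denq s.
have al0 : al != 0 by rewrite mulf_neq0 ?numq_eq0 ?denq_eq0.
have sal : al%:~R = (denq s * denq t)%:~R * s.
  by rewrite !rmorphM /= numqE; ring.
have tbe : be%:~R = (denq s * denq t)%:~R * t.
  by rewrite !rmorphM /= numqE; ring.
(* Up to the factor [denq s * denq t], the value of [w] at this integer vector is the determinant of
   [v] and [w] at [cs n] and [c], which is also the value at [c] of the tuple given below. *)
have [|w [hw w0 wc]] := IH (fun i => c i * al - cs n i * be).
  move=> m ms m0.
  have := ind (al * m) (fun i => if (i < n)%N then ms i else be * m) (mulf_neq0 al0 m0).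
  rewrite big_ord_recr /= ltnn lcB !lcM mulrzBl -!mulrzA.
  under eq_bigr => i _ do rewrite ltn_ord.
  by rewrite opprD addrA addrAC.
exists (fun i => s * w i - dot r (cs n) w * v i); split.
- by apply: hom_valuesB => //; [exact: hom_values_dot hv|exact: hom_values_dot hw].
- move=> i; rewrite ltnS leq_eqVlt dotBr !dotMr => /orP[/eqP->|i_n].
    by rewrite -/s mulrC subrr.
  by rewrite w0 // v0 // !mulr0 subr0.
- apply: contraNneq wc; rewrite dotBr !dotMr -/t dotBl !dotMl sal tbe => E.
  rewrite -!mulrA -mulrBr mulf_eq0 [t * _]mulrC E eqxx orbT //.
Qed.

Definition purification H e n : set G :=
  [set x | exists m c, (0 < m)%N /\ H (x *+ m - lc e n c)].

End Subgroups.

(** * Pure finite rank extensions of a subgroup and their cyclic quotients *)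

Section Bases.
Variable G : zmodType.
Implicit Types (H K B : set G) (x y : G) (e : nat -> G) (c : nat -> int) (v : nat -> rat).

(** Cross-multiplication of denominators. The case [k = 1] gives closure under subtraction; general
    [k] serves to remove a multiple of a generator. *)
Lemma relationB H e r m m' c c' x y (k : int) : subgroup H ->
  H (x *+ m - lc e r c) -> H (y *+ m' - lc e r c') ->
  H ((x - y *~ k) *+ (m * m') - lc e r (fun i => c i * m'%:Z - c' i * (k * m%:Z))).
Proof.
move=> sH Hx Hy; rewrite lcB !lcM mulrnBl.
rewrite (_ : _ - _ = (x *+ m - lc e r c) *~ m' - (y *+ m' - lc e r c') *~ (k * m%:Z)).
  by apply: subgroupB => //; exact: subgroupMz.
have -> : y *~ k *+ (m * m') = y *+ m' *~ (k * m%:Z).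
  by rewrite !pmulrn -!mulrzA PoszM; congr (_ *~ _); ring.
rewrite !mulrzBl mulrnA -pmulrn !opprB [X in _ + X = _]addrC addrACA.
by rewrite [X in _ + X = _]addrC.
Qed.

Lemma purification_pure H e n : pure_subgroup H -> pure_subgroup (purification H e n).
Proof.
move=> [sH pH]; split; [split|].
- by exists 1%N, (fun=> 0); rewrite mulr1n lc0 subr0; split=> //; case: sH.
- move=> x y [m [c [m0 Hx]]] [m' [c' [m'0 Hy]]].
  exists (m * m')%N, (fun i => c i * m'%:Z - c' i * (1 * m%:Z)).
  rewrite muln_gt0 m0 m'0 -[y in x - y]mulr1z; split=> //; exact: relationB.
- move=> k x k0 [m [c [m0 Hx]]]; exists (k * m)%N, c.
  by rewrite muln_gt0 k0 m0 mulrnA.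
Qed.

Lemma sub_purification H e n : H `<=` purification H e n.
Proof. by move=> x Hx; exists 1%N, (fun=> 0); rewrite mulr1n lc0 subr0. Qed.

Lemma purification_le H e m n : (m <= n)%N -> purification H e m `<=` purification H e n.
Proof.
move=> mn x [k [c [k0 Hx]]]; exists k, (fun i => if (i < m)%N then c i else 0); split=> //.
suff -> : lc e n (fun i => if (i < m)%N then c i else 0) = lc e m c by [].
rewrite /lc (big_ord_widen n (fun i => e i *~ c i) mn) [RHS]big_mkcond /=.
by apply: eq_bigr => i _; case: ifP; rewrite ?mulr0z.
Qed.

Lemma mem_purification H e i n : H 0 -> (i < n)%N -> purification H e n (e i).
Proof.
move=> H0 i_n; exists 1%N, (fun j => (j == i)%:Z).
by rewrite mulr1n lc_delta // subrr.
Qed.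

Lemma purification_min H K e n : pure_subgroup K -> H `<=` K ->
  (forall i, (i < n)%N -> K (e i)) -> purification H e n `<=` K.
Proof.
move=> [sK pK] HK Ke x [m [c [m0 /HK Hx]]]; apply: (pK m) => //.
rewrite -[_ *+ _](subrK (lc e n c)); apply: subgroupD => //.
by apply: subgroup_sum => // i _; apply: subgroupMz => //; exact: Ke.
Qed.

(** The coordinate along [e n] embeds the quotient of consecutive purifications into the rationals.
    Homomorphisms into Z[1/2] and Z[1/3] that see only this coordinate bound its denominators, so
    the image is a cyclic group. *)
Lemma purification_cyclic_step H e n : pure_subgroup H ->
  ~ unseparated 2 H -> ~ unseparated 3 H ->
  exists2 b, purification H e n.+1 b &
    forall x, purification H e n.+1 x ->
      exists k : int, purification H e n (x - b *~ k).
Proof.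
move=> pH u2 u3; have [sH _] := pH.
have [sK pK] := purification_pure e n pH.
have [Ken|nKen] := pselect (purification H e n (e n)).
  exists 0; first by apply: sub_purification; case: sH.
  move=> x xP; exists 0; rewrite mulr0z subr0.
  apply: purification_min xP => //; first exact: sub_purification.
  move=> i; rewrite ltnS leq_eqVlt => /orP[/eqP->//|].
  by apply: mem_purification; case: sH.
(* As [e n] lies outside the purification of the earlier generators, no nonzero multiple of it
   depends on them modulo [H]. *)
have sep q : ~ unseparated q H -> exists v, hom_values q H e n.+1 v /\
    (forall i, (i < n)%N -> v i = 0) /\ v n != 0.
  move=> uq; have [|v [hv v0 vn]] := @separating_values _ q H e n.+1
      (fun j i => (i == j)%:Z) n (fun i => (i == n)%:Z) uq.
    move=> m ms m0 Hm; apply: nKen.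
    apply: (@pure_subgroupMz _ _ _ m) => //.
    exists 1%N, ms; split=> //; rewrite mulr1n.
    move: Hm; rewrite lc_delta //; congr (H (_ - _)).
    by apply: eq_bigr => i _; rewrite lc_delta // leqW.
  exists v; split=> //; split=> [i i_n|]; last by rewrite dot_delta in vn.
  by have := v0 _ i_n; rewrite dot_delta // leqW.
have [v2 [[_ h2] [z2 n2]]] := sep _ u2; have [v3 [[_ h3] [z3 n3]]] := sep _ u3.
(* Both numerators enter, so that [D] is an integer multiple of [v2 n] and of [v3 n]. Hence [D]
   times a coordinate lies in Z[1/2] and in Z[1/3]. *)
pose D : int := numq (v2 n) * numq (v3 n).
have D0 : D != 0 by rewrite mulf_neq0 ?numq_eq0.
(* [j] is [D] times the coordinate [c n / m] of [x] along [e n]. *)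
pose coord x (j : int) := exists m c, [/\ (0 < m)%N, H (x *+ m - lc e n.+1 c)
  & j * m%:Z = c n * D].
have coordP x : purification H e n.+1 x -> exists j, coord x j.
  move=> [m [c [m0 Hx]]].
  have dn v : (forall i, (i < n)%N -> v i = 0) -> dot n.+1 c v = (c n)%:~R * v n.
    by move=> v0; rewrite /dot big_ord_recr big1 /= ?add0r // => i _; rewrite v0 ?mulr0.
  have m0' : m%:R != 0 :> rat by rewrite pnatr_eq0 -lt0n.
  have Z2 : Zloc 2 ((c n * D)%:~R / m%:R).
    have := ZlocM (h2 _ _ _ m0 Hx) (Zloc_int 2 (denq (v2 n) * numq (v3 n))).
    by rewrite dn //; congr (Zloc _ _); rewrite !rmorphM /= [(numq (v2 n))%:~R]numqE; ring.
  have Z3 : Zloc 3 ((c n * D)%:~R / m%:R).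
    have := ZlocM (h3 _ _ _ m0 Hx) (Zloc_int 3 (denq (v3 n) * numq (v2 n))).
    by rewrite dn //; congr (Zloc _ _); rewrite !rmorphM /= [(numq (v3 n))%:~R]numqE; ring.
  have [j jE] := Zloc_coprime (isT : coprime 2 3) Z2 Z3.
  exists j, m, c; split=> //; apply: (@intr_inj rat).
  by rewrite rmorphM /= -jE -pmulrn divfK.
have [j0 [b [mb [cb [mb0 Hb jb]]]] jmin] : exists2 j0,
    exists b, coord b j0 & forall x j, coord x j -> exists k, j = k * j0.
  have [||j0 jb jP] := @int_subgroup_principal [set j | exists b, coord b j].
  - exists 0, 1%N, (fun=> 0); rewrite mul0rn lc0 subrr !mul0r.
    by split=> //; case: sH.
  - move=> i j [x [m [c [m0 Hx E]]]] [y [m' [c' [m'0 Hy E']]]].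
    exists (x - y *~ 1), (m * m')%N, (fun i => c i * m'%:Z - c' i * (1 * m%:Z)).
    rewrite muln_gt0 m0 m'0; split=> //; first exact: relationB.
    transitivity (i * m%:Z * m'%:Z - j * m'%:Z * m%:Z); first by rewrite PoszM; ring.
    by rewrite E E'; ring.
  - by exists j0 => // x j xj; apply: jP; exists x.
exists b; first by exists mb, cb.
move=> x xP; have [j xj] := coordP x xP; have [k jk] := jmin _ _ xj.
have [m [c [m0 Hx E]]] := xj; exists k.
(* The coefficients of [x - b *~ k] after cross-multiplication; the last one vanishes by the choice
   of [k], so [e n] drops out. *)
pose d i := c i * mb%:Z - cb i * (k * m%:Z).
have dn : d n = 0.
  apply/eqP; rewrite -(mulIr_eq0 _ (mulIf D0)) /d; apply/eqP.
  transitivity ((c n * D) * mb%:Z - (cb n * D) * (k * m%:Z)); first by ring.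
  by rewrite -E -jb jk; ring.
exists (m * mb)%N, d; rewrite muln_gt0 m0 mb0; split=> //.
have -> : lc e n d = lc e n.+1 d by rewrite /lc big_ord_recr /= dn mulr0z addr0.
exact: relationB.
Qed.
End Bases.

(** * Independence modulo a subgroup and bases *)

Lemma seq_max_image d (I : orderType d) (T : eqType) (f : T -> I) x0 (s : seq T) :
  exists2 x, x \in x0 :: s & forall y, y \in x0 :: s -> (f y <= f x)%O.
Proof.
elim: s x0 => [|y s IH] x0.
  by exists x0 => [|y]; rewrite inE // => /eqP->.
have [x xs xmax] := IH y; have [le|lt] := leP (f x0) (f x).
  exists x => [|z]; first by rewrite inE xs orbT.
  by rewrite inE => /orP[/eqP->//|]; exact: xmax.
exists x0 => [|z]; first exact: mem_head.
rewrite inE => /orP[/eqP->//|/xmax zx]; exact: le_trans zx (ltW lt).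
Qed.

Lemma countable_enum T (K : set T) x0 : K x0 -> countable K ->
  exists e : nat -> T, (forall n, K (e n)) /\ forall x, K x -> exists n, e n = x.
Proof.
move=> Kx0 /countable_injP[f finj].
have /choice[e eP] : forall n, exists x, K x /\ forall y, K y -> f y = n -> x = y.
  move=> n; have [[y [Ky fy]]|no] := pselect (exists y, K y /\ f y = n).
    exists y; split=> // z Kz fz; apply: finj; rewrite ?inE //.
    by rewrite fy fz.
  by exists x0; split=> // y Ky fy; case: no; exists y.
exists e; split=> [n|x Kx]; first by case: (eP n).
by exists (f x); case: (eP (f x)) => _; exact.
Qed.

Section Independence.
Variable G : zmodType.
Implicit Types (H K B : set G) (x y : G).

Definition independent_mod H B := forall (s : seq G) (a : G -> int),
  uniq s -> (forall x, x \in s -> B x) -> H (\sum_(x <- s) x *~ a x) ->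
  forall x, x \in s -> a x = 0.

Definition generated H B : set G :=
  [set x | forall K, subgroup K -> H `<=` K -> B `<=` K -> K x].

Lemma generated_subgroup H B : subgroup (generated H B).
Proof.
split=> [K [] //|x y gx gy K sK HK BK].
by apply: subgroupB => //; [exact: gx|exact: gy].
Qed.

Lemma sub_generatedl H B : H `<=` generated H B.
Proof. by move=> x Hx K _ HK _; exact: HK. Qed.

Lemma sub_generatedr H B : B `<=` generated H B.
Proof. by move=> x Bx K _ _; exact. Qed.

(** In a relation, all terms below the highest occurring index [i] lie in [Hs i], so independence
    modulo [Hs i] kills the top coefficients. The remaining relation is shorter. *)
Lemma independent_mod_bigcup d (I : orderType d) (L : set I) (Hs Bs : I -> set G) H :
  (forall i, L i -> subgroup (Hs i)) -> (forall i, L i -> H `<=` Hs i) ->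
  (forall i, L i -> independent_mod (Hs i) (Bs i)) ->
  (forall i j, L i -> L j -> (i < j)%O -> Bs i `<=` Hs j) ->
  independent_mod H (\bigcup_(i in L) Bs i).
Proof.
move=> sH HH indB BH s; have [n] := ubnP (size s); elim: n s => // n IH [//|x0 s] sn a us sB Hs0.
have [f fP] : exists f : G -> I, forall x, x \in x0 :: s -> L (f x) /\ Bs (f x) x.
  have [i0 _ _] := sB _ (mem_head _ _).
  have /choice[f fP] : forall x, exists i, x \in x0 :: s -> L i /\ Bs i x.
    by move=> x; have [/sB[i Li Bi]|nx] := boolP (x \in x0 :: s); [exists i|exists i0].
  by exists f.
have [m ms mmax] := seq_max_image f x0 s.
set t := x0 :: s in sn us sB Hs0 fP ms mmax *.
clearbody t; have [Lm _] := fP m ms.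
have split_sum : \sum_(x <- t) x *~ a x = \sum_(x <- [seq x <- t | f x == f m]) x *~ a x
    + \sum_(x <- [seq x <- t | f x != f m]) x *~ a x.
  by rewrite (bigID (fun x => f x == f m)) /= !big_filter.
have low : Hs (f m) (\sum_(x <- [seq x <- t | f x != f m]) x *~ a x).
  apply: subgroup_sum_seq; first exact: sH.
  move=> x; rewrite mem_filter => /andP[xm xt]; have [Lx Bx] := fP x xt.
  apply: subgroupMz; first exact: sH.
  by apply: (BH (f x)) => //; rewrite lt_neqAle xm mmax.
have top x : x \in t -> f x = f m -> a x = 0.
  move=> xt xm; apply: (indB (f m) Lm [seq x <- t | f x == f m] a).
  - exact: filter_uniq.
  - by move=> y; rewrite mem_filter => /andP[/eqP<- /fP[]].
  - have := subgroupB (sH _ Lm) (HH _ Lm _ Hs0) low.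
    by rewrite split_sum addrK.
  - by rewrite mem_filter xm eqxx xt.
move=> x xt; have [/top->//|xm] := eqVneq (f x) (f m).
apply: (IH [seq x <- t | f x != f m]).
- rewrite -ltnS; apply: leq_trans sn; rewrite ltnS size_filter -(count_predC (fun x => f x == f m) t).
  rewrite -add1n leq_add2r -has_count; apply/hasP; exists m => //=.
- exact: filter_uniq.
- by move=> y; rewrite mem_filter => /andP[_ /sB].
- move: Hs0; rewrite split_sum big1_seq ?add0r // => y /andP[_].
  by rewrite mem_filter => /andP[/eqP ym yt]; rewrite top ?mulr0z.
- by rewrite mem_filter xm.
Qed.

Lemma independent_mod1 H b : pure_subgroup H -> ~ H b -> independent_mod H [set b].
Proof.
move=> pH nHb [|y [|z s]] a us sb //.
  have -> : y = b by apply: sb; exact: mem_head.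
  rewrite big_seq1 => Hb x; rewrite inE => /eqP->.
  by apply: contrapT => /eqP ab; apply: nHb; exact: pure_subgroupMz Hb.
move: us; rewrite /= inE negb_or => /andP[/andP[/eqP yz _] _]; case: yz.
by rewrite (sb y (mem_head _ _)) (sb z) // !inE eqxx orbT.
Qed.

(* Pontryagin's criterion, relative to H. *)
Lemma countable_basis_mod H K : pure_subgroup H -> pure_subgroup K ->
  countable K -> H `<=` K -> ~ unseparated 2 H -> ~ unseparated 3 H ->
  exists B, [/\ B `<=` K, independent_mod H B & K `<=` generated H B].
Proof.
move=> pH pK cK HK u2 u3; have [[H0 HB] _] := pH.
have [e [Ke eK]] := countable_enum (HK _ H0) cK.
have /choice[b bP] : forall n, exists b, purification H e n.+1 b /\
    forall x, purification H e n.+1 x -> exists k : int, purification H e n (x - b *~ k).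
  by move=> n; have [b bn bP] := purification_cyclic_step e n pH u2 u3; exists b.
(* Only the stages at which [b n] is new contribute a basis element. *)
pose L := [set n | ~ purification H e n (b n)].
have PK n : purification H e n `<=` K by exact: purification_min.
exists (\bigcup_(n in L) [set b n]); split.
- by move=> _ [n _ ->]; apply: (PK n.+1); case: (bP n).
- apply: (independent_mod_bigcup (Hs := purification H e)).
  + by move=> n _; case: (purification_pure e n pH).
  + by move=> n _; exact: sub_purification.
  + by move=> n Ln; apply: independent_mod1 => //; exact: purification_pure.
  + move=> i j _ _ ij _ ->; apply: (purification_le (m := i.+1)) => //.
    by case: (bP i).
- have gen n : purification H e n `<=` generated H (\bigcup_(n in L) [set b n]).
    elim: n => [|n IH] x xP.
      have [m [c [m0 Hx]]] := xP; apply: sub_generatedl.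
      by apply: pH.2 m0 _; move: Hx; rewrite /lc big_ord0 subr0.
    have [_ /(_ x xP)[k /IH gk]] := bP n.
    rewrite -[x](subrK (b n *~ k)).
    apply: (subgroupD (generated_subgroup _ _)) => //.
    apply: (subgroupMz (generated_subgroup _ _)).
    have [Pb|nPb] := pselect (purification H e n (b n)); first exact: IH.
    by apply: sub_generatedr; exists n.
  move=> x /eK[n <-]; apply: (gen n.+1); exact: mem_purification.
Qed.

Lemma free_abelian_of_basis B : independent_mod [set 0] B ->
  (forall x, generated [set 0] B x) -> free_abelian (@predT G).
Proof.
move=> ind gen.
exists (fun x => `[< B x >]); split=> //.
  move=> s a us sB s0 x xs; apply: (ind s a) => // y /sB.
  by rewrite unfold_in => /asboolP.
(* Coefficients belong to elements and not to positions in [s]. With distinct entries, a further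
   multiple of some [b] in [s] is absorbed into the coefficient of [b]. *)
pose P := [set x : G | exists (s : seq G) (a : G -> int),
   [/\ uniq s, (forall x, x \in s -> B x) & x = \sum_(y <- s) y *~ a y]].
have PD b k x : B b -> P x -> P (x + b *~ k).
  move=> Bb [s [a [us sB ->]]]; have [bs|nbs] := boolP (b \in s).
    exists s, (fun y => a y + (if y == b then k else 0)); split=> //.
    under [RHS]eq_bigr => y _ do rewrite mulrzDr.
    rewrite big_split /=; congr (_ + _).
    rewrite (bigD1_seq b) //= eqxx big1 ?addr0 // => y /negbTE->.
    by rewrite mulr0z.
  exists (b :: s), (fun y => if y == b then k else a y); split.
  - by rewrite /= nbs.
  - by move=> y; rewrite inE => /orP[/eqP->//|/sB].
  - rewrite big_cons eqxx addrC; congr (_ + _).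
    apply: eq_big_seq => y ys; case: eqP => // yb.
    by move: nbs; rewrite -yb ys.
have PS x y : P x -> P y -> P (x - y).
  move=> Px [s [a [_ sB ->]]]; elim: s sB => [|z s IH] sB; first by rewrite big_nil subr0.
  rewrite big_cons opprD addrCA addrC -mulrNz; apply: PD; first exact/sB/mem_head.
  by apply: IH => t ts; apply: sB; rewrite inE ts orbT.
move=> y _; have [|||s [a [us sB ->]]] := gen y P.
- split=> //; exists [::], (fun=> 0); split=> //; by rewrite big_nil.
- by move=> _ ->; exists [::], (fun=> 0); split=> //; rewrite big_nil.
- move=> b Bb; rewrite -[b]add0r -[b]mulr1z; apply: PD => //.
  by exists [::], (fun=> 0); split=> //; rewrite big_nil.
exists s, a; split=> // x /sB Bx; rewrite unfold_in; exact/asboolP.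
Qed.

End Independence.

(** * The filtration *)

Lemma countable_preimage T U (f : T -> U) (X : set U) :
  injective f -> countable X -> countable (f @^-1` X).
Proof.
move=> finj /countable_injP[g ginj]; apply/countable_injP; exists (g \o f).
by move=> x y; rewrite !inE => Xx Xy /ginj E; apply/finj/E; rewrite inE.
Qed.

Definition torsion_free (G : zmodType) := forall m (x : G), (0 < m)%N -> x *+ m = 0 -> x = 0.

Section Filtration.
Variables (G : zmodType) (idx : G -> omega1).
Hypothesis idx_inj : injective idx.
Implicit Types (d a : omega1) (x y : G).

(** The sets H_d. Zero is included whatever its index, so that the filtration starts with the zero
    subgroup. *)
Definition initial d : set G := [set x | x = 0 \/ (idx x < d)%O].

Lemma initial_countable d : countable (initial d).
Proof.
apply: (@countable_setU _ [set 0]) => //.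
exact: countable_preimage (omega1_initial_countable d).
Qed.

Lemma initial_le a d : (a <= d)%O -> initial a `<=` initial d.
Proof. by move=> ad x [->|xa]; [left|right; exact: lt_le_trans ad]. Qed.

Lemma mem_initial x : initial (osucc (idx x)) x.
Proof. by right; exact: lt_osucc. Qed.

Lemma initial_limit d x : limit d -> initial d x ->
  exists2 a, (a < d)%O & initial a x.
Proof.
move=> ld [->|xd]; first by case: ld => -[a ad] _; exists a => //; left.
by exists (osucc (idx x)); [exact: limit_osucc|exact: mem_initial].
Qed.

Lemma initial_limit2 d x y : limit d -> initial d x -> initial d y ->
  exists a, [/\ (a < d)%O, initial a x & initial a y].
Proof.
move=> ld /(initial_limit ld)[a ad ax] /(initial_limit ld)[b bd by_].
exists (Order.max a b); rewrite gt_max ad bd; split=> //.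
  by apply: initial_le ax; rewrite le_max lexx.
by apply: initial_le by_; rewrite le_max lexx orbT.
Qed.

(** [F] bounds the indices of all differences and all quotients by positive integers of elements of
    [initial a]. There are countably many, division being unique in a torsion-free group. *)
Lemma initial_pure_club : torsion_free G ->
  exists F, forall d, closed_points F d -> pure_subgroup (initial d).
Proof.
move=> tf.
pose X a := (fun p => idx (p.1 - p.2)) @` (initial a `*` initial a) `|`
  idx @` (\bigcup_(m in [set m | (0 < m)%N]) (fun x : G => x *+ m) @^-1` initial a).
have /choice[F FP] : forall a, exists b, forall u, X a u -> (u < b)%O.
  move=> a; apply: countable_lt_bounded; apply: countable_setU; apply: countable_image.
    by apply: countableX; exact: initial_countable.
  apply: bigcup_countable => // m m0; apply: countable_preimage; last exact: initial_countable.
  move=> x y /eqP; rewrite -subr_eq0 -mulrnBl => /eqP/(tf _ _ m0)/eqP.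
  by rewrite subr_eq0 => /eqP.
exists F => d [ld Fd]; split; first split; first by left.
- move=> x y xd yd; have [a [ad ax ay]] := initial_limit2 ld xd yd.
  right; apply: lt_trans (Fd _ ad); apply: FP; left.
  by exists (x, y).
- move=> m x m0 xd; have [a ad ax] := initial_limit ld xd.
  right; apply: lt_trans (Fd _ ad); apply: FP; right.
  by exists x => //; exists m.
Qed.

(** Bases of the quotients of [initial (nxt d)] by [initial d], taken along the club and its
    starting point [o], unite to a basis of [G]. *)
Lemma free_of_separated_club F : torsion_free G ->
  (forall q, q \in [:: 2; 3]%N -> ~ unseparated q [set 0 : G]) ->
  (forall d, closed_points F d -> pure_subgroup (initial d) /\
     forall q, q \in [:: 2; 3]%N -> ~ unseparated q (initial d)) ->
  free_abelian (@predT G).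
Proof.
move=> tf sep0 sepF.
have [o _ omin] : exists2 o : omega1, True & forall a, (o <= a)%O.
  have [d _ _] := closed_points_above id (osucc (idx 0)).
  have [|o _ omin] := @omega1_well_ordered setT; first by exists d.
  by exists o => // a; exact: omin.
have init_o : initial o = [set 0].
  apply/seteqP; split=> x; [move=> [->|xo] // | by left].
  by move: xo; rewrite ltNge omin.
pose L := [set d | d = o \/ closed_points F d].
have LP d : L d -> pure_subgroup (initial d) /\
     forall q, q \in [:: 2; 3]%N -> ~ unseparated q (initial d).
  case=> [->|]; last exact: sepF.
  rewrite init_o; split=> //; split; last by move=> m x m0 /(tf _ _ m0).
  by split=> // x y -> ->; rewrite subrr.
have /choice[nxt nxtP] : forall d, exists d', [/\ (d < d')%O, closed_points F d'
    & forall e, closed_points F e -> (d < e)%O -> (d' <= e)%O].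
  move=> d; have [e Fe de] := closed_points_above F d.
  have [|d' [Fd' dd'] dmin] := @omega1_well_ordered [set e | closed_points F e /\ (d < e)%O].
    by exists e.
  by exists d'; split=> // u Fu du; exact: dmin.
have /choice[B BP] : forall d, exists B, L d -> [/\ B `<=` initial (nxt d),
    independent_mod (initial d) B & initial (nxt d) `<=` generated (initial d) B].
  move=> d; have [Ld|nLd] := pselect (L d); last by exists set0.
  have [pd sepd] := LP d Ld; have [dn Fn _] := nxtP d.
  have [pn _] := LP (nxt d) (or_intror Fn).
  have [B BP] := countable_basis_mod pd pn (initial_countable _) (initial_le (ltW dn))
    (sepd 2%N isT) (sepd 3%N isT).
  by exists B.
pose U := \bigcup_(d in L) B d.
apply: (@free_abelian_of_basis _ U).
  apply: (independent_mod_bigcup (Hs := initial)).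
  - by move=> d /LP[[]].
  - by move=> d _ x ->; left.
  - by move=> d /BP[].
  - move=> d e Ld [->|Fe] de; first by rewrite ltNge omin in de.
    have [Bd _ _] := BP d Ld; apply: subset_trans Bd _; apply: initial_le.
    by have [_ _] := nxtP d; exact.
have [sg gB] : subgroup (generated [set 0] U) /\ U `<=` generated [set 0] U.
  by split; [exact: generated_subgroup|exact: sub_generatedr].
have step d : L d -> initial d `<=` generated [set 0] U ->
    initial (nxt d) `<=` generated [set 0] U.
  move=> Ld gd x xn; have [_ _ /(_ x xn)] := BP d Ld.
  by apply=> // y By; apply: gB; exists d.
suff all_d d : initial d `<=` generated [set 0] U.
  by move=> x; exact: all_d (mem_initial x).
apply: contrapT => nd.
(* At a least failure [t], no member of [L] below [t] has its successor [nxt] at or above [t]. So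
   the supremum [l] of these members is itself a club point, which forces [l = t]; then [initial t]
   is the union of smaller ones. *)
have [|t nt tmin] := @omega1_well_ordered [set d | ~ (initial d `<=` generated [set 0] U)].
  by exists d.
have below a : (a < t)%O -> initial a `<=` generated [set 0] U.
  by move=> at_; apply: contrapT => /tmin; rewrite leNgt at_.
have ot : (o < t)%O.
  rewrite lt_neqAle omin andbT; apply/eqP => ot; apply: nt.
  by rewrite -ot init_o; exact: sub_generatedl.
have nxt_lt e : L e -> (e < t)%O -> (nxt e < t)%O.
  move=> Le et; rewrite ltNge; apply/negP => /initial_le tn; apply: nt.
  exact: subset_trans tn (step _ Le (below _ et)).
have [|l lub lmin] := @omega1_lub [set e | L e /\ (e < t)%O] t.
  by move=> e [_ /ltW].
have lt_l e : L e -> (e < t)%O -> (e < l)%O.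
  move=> Le et; have [en Fn _] := nxtP e.
  apply: lt_le_trans en _; apply: lub; split; [by right|exact: nxt_lt].
have cof a : (a < l)%O -> exists2 e, closed_points F e & (a < e < l)%O.
  move=> al; apply: contrapT => nex; move: al; rewrite ltNge => /negP; apply.
  apply: lmin => e [Le et]; rewrite leNgt; apply/negP => ae; apply: nex.
  have [en Fn _] := nxtP e; exists (nxt e) => //; apply/andP; split.
    exact: lt_trans ae en.
  by apply: lt_l; [right|exact: nxt_lt].
have lim_l : limit l.
  split; first by exists o; apply: lt_l => //; left.
  by move=> a /cof[e _ ael]; exists e.
have Fl : closed_points F l by exact: closed_points_lim.
have lt_ : (l <= t)%O by apply: lmin => e [_ /ltW].
have lE : l = t.
  apply/eqP; rewrite eq_le lt_ leNgt; apply/negP => l_t.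
  by have := lt_l l (or_intror Fl) l_t; rewrite ltxx.
apply: nt => x; rewrite -lE => /(initial_limit lim_l)[a al].
by apply: below; rewrite -lE.
Qed.

End Filtration.

(** * Consequences of separability *)

Section Separability.
Variable G : zmodType.
Implicit Types (H A D P : set G) (x y z b g : G).

Lemma zmodClosed_subgroup H : subgroup H ->
  exists A : zmodClosed G, forall x, (x \in A) = `[< H x >].
Proof.
move=> sH; pose S : {pred G} := fun x => `[< H x >].
have clS : zmod_closed S.
  split=> [|x y]; first by apply/asboolP; case: sH.
  by rewrite !unfold_in => /asboolP Hx /asboolP Hy; apply/asboolP; exact: subgroupB.
pose A : zmodClosed G := HB.pack S (GRing.isZmodClosed.Build G S clS).
by exists A => x; rewrite unfold_in.
Qed.

(** For [z = 0] these are the torsion elements, so one definition serves ranks zero and one. *)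
Definition rank1_over z x := exists m (k : int), (0 < m)%N /\ x *+ m = z *~ k.

Lemma rank1_lin_indep z (B : {pred G}) x y : lin_indep B -> x \in B -> y \in B ->
  rank1_over z x -> rank1_over z y -> x = y.
Proof.
move=> ind Bx By [m [k [m0 xm]]] [m' [k' [m'0 ym]]].
apply: contrapT => /eqP xy.
have rel i j : x *~ i + y *~ j = 0 -> i = 0 /\ j = 0.
  pose a t := if t == x then i else j => E.
  have aE : forall t, t \in [:: x; y] -> a t = 0.
    apply: ind; first by rewrite /= inE xy.
      by move=> t; rewrite !inE => /orP[]/eqP->.
    by rewrite big_cons big_seq1 /a eqxx eq_sym (negbTE xy).
  have := aE x (mem_head _ _); have := aE y.
  by rewrite !inE eqxx orbT /a eqxx eq_sym (negbTE xy) => /(_ isT).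
have [k0|k0] := eqVneq k 0.
  have [|m00 _] := rel m%:Z 0; first by rewrite mulr0z addr0 -pmulrn xm k0 mulr0z.
  by move: m0; rewrite -ltz_nat m00.
have [|_ /eqP] := rel (m%:Z * k') (- (m'%:Z * k)).
  by rewrite mulrNz !mulrzA -!pmulrn xm ym -!mulrzA mulrC subrr.
by rewrite oppr_eq0 mulf_eq0 (negbTE k0) orbF eqz_nat -leqn0 leqNgt m'0.
Qed.

Lemma finite_rank1 z (A : {pred G}) :
  (forall x, x \in A -> rank1_over z x) -> finite_rank A.
Proof.
move=> Az; exists 1%N => -[|x [|y s]] // us sA ind; exfalso.
have xs : x \in [:: x, y & s] by exact: mem_head.
have ys : y \in [:: x, y & s] by rewrite !inE eqxx orbT.
have xy := rank1_lin_indep ind xs ys (Az _ (sA _ xs)) (Az _ (sA _ ys)).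
by move: us; rewrite xy /= mem_head.
Qed.

Lemma lin_indep_nontorsion (B : {pred G}) b m :
  lin_indep B -> b \in B -> (0 < m)%N -> b *+ m <> 0.
Proof.
move=> ind bB m0 bm; have := ind [:: b] (fun=> m%:Z) isT.
have sb : {subset [:: b] <= B} by move=> x; rewrite inE => /eqP->.
rewrite big_seq1 -pmulrn => /(_ sb bm b (mem_head _ _)) m00.
by move: m0; rewrite -ltz_nat m00.
Qed.

Hypothesis hs : hereditarily_separable G.

(** Separability in terms of sets, for pure subgroups of rank at most one. *)
Lemma separable_subgroup A P z : subgroup A -> subgroup P -> P `<=` A ->
  (forall m g, (0 < m)%N -> A g -> P (g *+ m) -> P g) ->
  (forall x, P x -> rank1_over z x) ->
  (exists B : {pred G}, [/\ forall x, x \in B -> P x, lin_indep B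
     & forall x, P x -> in_span B x]) /\
  exists D, [/\ subgroup D, D `<=` A,
    forall g, A g -> exists p d, [/\ P p, D d & g = p + d] &
    forall x, P x -> D x -> x = 0].
Proof.
move=> sA sP PA pureP rankP.
have [A' A'E] := zmodClosed_subgroup sA; have [P' P'E] := zmodClosed_subgroup sP.
have [||[B [BP indB spanB]] [_ [D [DA dec DP]]]] := @hs A' P'.
- split=> [x|n g]; rewrite ?P'E ?A'E => /asboolP; first by move/PA/asboolP.
  move=> Ag /asboolP Pgn; have [n0|n0] := posnP n.
    by exists 0; rewrite ?n0 // P'E; apply/asboolP; case: sP.
  by exists g => //; rewrite P'E; apply/asboolP; exact: pureP Pgn.
- by apply: (@finite_rank1 z) => x; rewrite P'E => /asboolP; exact: rankP.
split.
  exists B; split=> // [x /BP|x Px]; first by rewrite P'E => /asboolP.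
  by apply: spanB; rewrite P'E; exact/asboolP.
exists [set x | x \in D]; split.
- by split=> [|x y xD yD] /=; [exact: rpred0|exact: rpredB].
- by move=> x /DA; rewrite A'E => /asboolP.
- move=> g Ag; have [|p [d [pP dD ->]]] := dec g; first by rewrite A'E; exact/asboolP.
  by exists p, d; split=> //; move: pP; rewrite P'E => /asboolP.
- by move=> x Px; apply: DP; rewrite P'E; exact/asboolP.
Qed.

Lemma setT_subgroup : subgroup [set: G].
Proof. by split. Qed.

(** The torsion subgroup is pure of rank zero, hence free. No torsion element is independent, so its
    basis is empty. *)
Lemma hereditarily_separable_torsion_free : torsion_free G.
Proof.
pose T := [set x : G | exists2 m, (0 < m)%N & x *+ m = 0].
have sT : subgroup T.
  split; first by exists 1%N.
  move=> x y [m m0 xm] [n n0 yn]; exists (m * n)%N; first by rewrite muln_gt0 m0.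
  by rewrite mulrnBl mulrnA xm mulnC mulrnA yn !mul0rn subrr.
have [//|||[B [BT indB spanB]] _] := @separable_subgroup setT T 0 setT_subgroup sT.
- move=> m g m0 _ [n n0 gn]; exists (m * n)%N; first by rewrite muln_gt0 m0.
  by rewrite mulrnA.
- by move=> x [m m0 xm]; exists m, 0; rewrite xm mulr0z.
move=> m x m0 xm; have [|s [a [sB ->]]] := spanB x; first by exists m.
case: s sB => [|b s] sB; first by rewrite big_nil.
have [n n0 bn] := BT b (sB b (mem_head _ _)).
by case: (lin_indep_nontorsion indB (sB b (mem_head _ _)) n0 bn).
Qed.

Lemma torsion_freeMz x (k : int) : x *~ k = 0 -> x = 0 \/ k = 0.
Proof.
move=> xk; have [|k0] := eqVneq k 0; [by right|left].
have p0 : pure_subgroup [set 0 : G].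
  split=> [|m y m0]; last exact: hereditarily_separable_torsion_free.
  by split=> // y t -> ->; rewrite subrr.
exact: (pure_subgroupMz p0 k0).
Qed.

(** Here the hereditary form of separability enters: [A] may be a proper subgroup. *)
Lemma cyclic_summand A d : subgroup A -> A d ->
  (forall m g (k : int), (0 < m)%N -> A g -> g *+ m = d *~ k -> exists j : int, g = d *~ j) ->
  exists D, [/\ subgroup D, D `<=` A,
    forall g, A g -> exists (k : int) y, D y /\ g = d *~ k + y &
    forall k : int, D (d *~ k) -> d *~ k = 0].
Proof.
move=> sA Ad pd; pose P := [set x : G | exists k : int, x = d *~ k].
have [||||_ [D [sD DA dec DP]]] := @separable_subgroup A P d sA.
- split; first by exists 0; rewrite mulr0z.
  by move=> _ _ [k ->] [l ->]; exists (k - l); rewrite mulrzBr.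
- by move=> _ [k ->]; exact: subgroupMz.
- by move=> m g m0 Ag [k gk]; exact: pd gk.
- by move=> _ [k ->]; exists 1%N, k; rewrite mulr1n.
exists D; split=> // [g /dec[_ [y [[k ->] Dy ->]]]|k Dk]; first by exists k, y.
by apply: DP => //; exists k.
Qed.

(** The pure hull of [z] has rank one, so separability makes it free on one element [b] and a direct
    summand; [phi] is the coordinate along [b]. *)
Lemma coordinate_exists z : z <> 0 ->
  exists b (phi : {additive G -> int}) (k : int), phi b = 1 /\ z = b *~ k.
Proof.
move=> z0; pose P := [set x : G | exists m (k : int), (0 < m)%N /\ x *+ m = z *~ k].
have sP : subgroup P.
  split; first by exists 1%N, 0; rewrite mulr0z mul0rn.
  move=> x y [m [k [m0 xm]]] [n [l [n0 yn]]].
  exists (m * n)%N, (k * n%:Z - l * m%:Z); rewrite muln_gt0 m0 n0; split=> //.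
  by rewrite mulrnBl mulrnA xm mulnC mulrnA yn mulrzBr !mulrzA -!pmulrn.
have [//||//|[B [BP indB spanB]] [D [sD _ dec DP]]] := @separable_subgroup setT P z setT_subgroup sP.
  move=> m g m0 _ [n [k [n0 gn]]]; exists (m * n)%N, k; rewrite muln_gt0 m0 n0.
  by rewrite mulrnA.
have Pz : P z by exists 1%N, 1.
have [b Bb] : exists b, b \in B.
  have [s [a [sB zE]]] := spanB z Pz; case: s sB zE => [|b s] sB.
    by rewrite big_nil.
  by move=> _; exists b; apply: sB; exact: mem_head.
have Pb := BP b Bb; have [mb [kb [mb0 bm]]] := Pb.
have Bone y : y \in B -> y = b.
  by move=> By; apply: rank1_lin_indep indB By Bb (BP _ By) Pb.
have Pmul x : P x -> exists k : int, x = b *~ k.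
  move=> /spanB[s [a [sB ->]]]; exists (\sum_(y <- s) a y).
  rewrite big_seq (eq_bigr (fun y => b *~ a y)) => [|y ys]; last by rewrite {1}(Bone y) ?sB.
  by rewrite -big_seq mulrz_sumr.
have b0 k : b *~ k = 0 -> k = 0.
  move=> /torsion_freeMz[b0|//].
  by case: (lin_indep_nontorsion indB Bb (isT : (0 < 1)%N)); rewrite b0 mul0rn.
have /choice[phi phiP] : forall g, exists k : int, exists2 c, D c & g = b *~ k + c.
  by move=> g; have [//|_ [c [/Pmul[k ->] Dc ->]]] := dec g; exists k, c.
have phiE g k c : D c -> g = b *~ k + c -> phi g = k.
  move=> Dc gE; have [c' Dc' gE'] := phiP g.
  have /DP E : P (b *~ (phi g - k)) by exact: subgroupMz.
  apply/eqP; rewrite -subr_eq0; apply/eqP/b0/E.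
  rewrite mulrzBr (_ : _ - _ = c - c'); first exact: subgroupB.
  by apply/eqP; rewrite subr_eq addrAC eq_sym subr_eq [c + _]addrC -gE -gE'.
have [k zk] := Pmul z Pz.
have phiB : zmod_morphism phi.
  move=> x y; have [c Dc xE] := phiP x; have [c' Dc' yE] := phiP y.
  apply: (@phiE _ _ (c - c')); first exact: subgroupB.
  by rewrite {1}xE {1}yE mulrzBr opprD addrACA.
pose f : {additive G -> int} := HB.pack phi (GRing.isZmodMorphism.Build G int phi phiB).
exists b, f, k; split=> //.
by apply: (@phiE _ _ 0); [case: sD|rewrite addr0 mulr1z].
Qed.

(** An integer-valued coordinate function that is nonzero at the given element separates it. This
    handles the bottom of the filtration. *)
Lemma not_unseparated0 q : ~ unseparated q [set 0 : G].
Proof.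
move=> [e [r [c [z0 noHom]]]]; have [b [phi [k [phib zE]]]] := coordinate_exists z0.
have phiMz x (n : int) : phi (x *~ n) = phi x * n by rewrite raddfMz mulrzz.
have philc f : (phi (lc e r f))%:~R = dot r f (fun i => (phi (e i))%:~R).
  rewrite /lc raddf_sum rmorph_sum; apply: eq_bigr => i _.
  by rewrite phiMz rmorphM /= mulrC.
have k0 : k != 0 by apply/eqP => k0; apply: z0; rewrite zE k0 mulr0z.
have /noHom : hom_values q [set 0] e r (fun i => (phi (e i))%:~R); last first.
  by rewrite -philc zE phiMz phib mul1r => /eqP; rewrite intr_eq0 (negbTE k0).
split=> [i|m x f m0 /eqP]; first exact: Zloc_int.
rewrite subr_eq0 => /eqP xE; rewrite -philc -xE pmulrn phiMz rmorphM /= -pmulrn mulfK.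
  exact: Zloc_int.
by rewrite pnatr_eq0 -lt0n.
Qed.

End Separability.

(** * Homomorphisms into Z[1/q] / qZ *)

(** Divisibility of Z[1/q] / qZ: powers of [q] are inverted outright, and the part of [n] prime to
    [q] is inverted modulo a high power of [q]. *)
Lemma subgroup_divide (q : nat) (n : int) (u : rat) : prime q -> n != 0 -> Zloc q u ->
  exists w (t : int), Zloc q w /\ n%:~R * w - u = (q%:Z * t)%:~R.
Proof.
move=> pq n0 [k [U uU]].
have n_gt0 : (0 < `|n|)%N by rewrite absz_gt0.
have [m qm nE] := pfactor_coprime pq n_gt0; set a := logn q _ in nE.
(* The exponent is [k.+1] because the error must still be divisible by [q] after the denominator
   [q^k] of [u] has been cancelled. *)
have /coprimezP[[al be] /= ab] : coprimez m%:Z (q%:Z ^+ k.+1).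
  by rewrite coprimezE !abszX !absz_nat coprime_sym coprimeXl.
have q0 : q%:R != 0 :> rat by rewrite pnatr_eq0 -lt0n prime_gt0.
exists ((sgz n * al * U)%:~R / q%:R ^+ (k + a)), (- (be * U)); split.
  exists (k + a)%N, (sgz n * al * U); rewrite divfK // expf_neq0 //.
have -> : u = U%:~R / q%:R ^+ k by rewrite -uU mulfK // expf_neq0.
have nR : n%:~R * (sgz n)%:~R = m%:R * q%:R ^+ a :> rat.
  by rewrite -intrM mulrC -abszEsg -pmulrn nE natrM natrX.
move/(congr1 (intr : int -> rat)): ab.
rewrite rmorphD rmorph1 /= !rmorphM /= rmorphXn /= -!pmulrn => ab.
have alE : m%:R * al%:~R = 1 - be%:~R * q%:R ^+ k.+1 :> rat.
  by apply: (addIr (be%:~R * q%:R ^+ k.+1)); rewrite subrK mulrC.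
rewrite rmorphN rmorphM /= exprD.
transitivity ((n%:~R * (sgz n)%:~R : rat) * al%:~R * U%:~R / (q%:R ^+ k * q%:R ^+ a) - U%:~R / q%:R ^+ k).
  by ring.
rewrite nR [m%:R * _ * al%:~R]mulrAC alE exprS; field.
by rewrite !expf_neq0.
Qed.

Section LocalCharacter.
Variables (G : zmodType) (q : nat).
Hypothesis q_prime : prime q.
Implicit Types (x y : G) (u v : rat) (M : set (G * rat)).

(* M is the graph of a partial homomorphism from G to Z[1/q] / qZ. *)
Definition local_graph M :=
  [/\ subgroup M, forall p, M p -> Zloc q p.2
    & forall u, M (0, u) -> exists t : int, u = (q%:Z * t)%:~R].

(** The chain condition for Zorn's lemma. Adjoining [M] to every member also covers the empty
    chain. *)
Lemma local_graph_bigcup (F : set (set (G * rat))) M : local_graph M ->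
  (forall X, F X -> local_graph (M `|` X)) -> total_on F subset ->
  local_graph (M `|` \bigcup_(X in F) X).
Proof.
move=> gM FG totF.
have cover p p' : (M `|` \bigcup_(X in F) X) p -> (M `|` \bigcup_(X in F) X) p' ->
    exists N, [/\ local_graph N, N `<=` M `|` \bigcup_(X in F) X, N p & N p'].
  have sub X : F X -> M `|` X `<=` M `|` \bigcup_(X in F) X.
    by move=> FX y [My|Xy]; [left|right; exists X].
  move=> [Mp|[X FX Xp]] [Mp'|[Y FY Yp']].
  - by exists M; split=> // y My; left.
  - by exists (M `|` Y); split; [exact: FG|exact: sub|left|right].
  - by exists (M `|` X); split; [exact: FG|exact: sub|right|left].
  - have [XY|YX] := totF X Y FX FY.
      by exists (M `|` Y); split; [exact: FG|exact: sub|right; exact: XY|right].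
    by exists (M `|` X); split; [exact: FG|exact: sub|right|right; exact: YX].
split.
- split; first by left; case: gM => -[].
  move=> p p' Up Up'; have [N [[sN _ _] NU Np Np']] := cover _ _ Up Up'.
  by apply: NU; exact: subgroupB.
- by move=> p Up; have [N [[_ ZN _] _ Np _]] := cover _ _ Up Up; exact: ZN.
- by move=> u Uu; have [N [[_ _ kN] _ Nu _]] := cover _ _ Uu Uu; exact: kN.
Qed.

Lemma pair_mulrz x u (k : int) : ((x, u) : G * rat) *~ k = (x *~ k, u *~ k).
Proof.
have nat_case n : ((x, u) : G * rat) *+ n = (x *+ n, u *+ n).
  by elim: n => [|n IH]; rewrite ?mulr0n // !mulrS IH.
by case: k => n; rewrite ?NegzE ?mulrNz -?pmulrn nat_case.
Qed.

(** The extension step for homomorphisms into a divisible group: if [n] generates the integers [i]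
    with [x *~ i] in the domain, the value at [x] has to be an [n]-th part of the one at
    [x *~ n]. *)
Lemma local_graph_extend M x : local_graph M ->
  exists N u, [/\ local_graph N, M `<=` N & N (x, u)].
Proof.
move=> [sM ZM kM].
have [||n [un Mn] nP] := @int_subgroup_principal [set i | exists u, M (x *~ i, u)].
- by exists 0; rewrite mulr0z; case: sM.
- by move=> i j [u Mu] [v Mv]; exists (u - v); rewrite mulrzBr; exact: (subgroupB sM Mu Mv).
have [w [t [Zw wE]]] : exists w (t : int), Zloc q w /\ n%:~R * w - un = (q%:Z * t)%:~R.
  (* For [n = 0] the value at [x] is unconstrained, and 0 is taken. *)
  have [n0|n0] := eqVneq n 0; last exact: subgroup_divide (ZM _ Mn).
  rewrite n0 mulr0z in Mn; have [t tE] := kM _ Mn.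
  exists 0, (- t); split; first exact: (Zloc_int q 0).
  by rewrite n0 mulr0 sub0r tE mulrN rmorphN.
pose N : set (G * rat) := [set p | exists p' i, M p' /\ p = p' + (x, w) *~ i].
exists N, w; split.
- split.
  + split; first by exists 0, 0; rewrite mulr0z addr0; split=> //; case: sM.
    move=> _ _ [p [i [Mp ->]]] [p' [j [Mp' ->]]].
    exists (p - p'), (i - j); split; first exact: subgroupB.
    by rewrite mulrzBr opprD addrACA.
  + move=> _ [p [i [Mp ->]]]; rewrite pair_mulrz /=.
    by apply: ZlocD; [exact: ZM|rewrite -mulrzl; apply: ZlocM => //; exact: Zloc_int].
  + move=> u [[y v] [i [Mp]]]; rewrite pair_mulrz => -[/esym/eqP yx ->].
    rewrite addr_eq0 in yx; have [j ij] : exists j, - i = j * n.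
      by apply: nP; exists v; rewrite mulrNz -(eqP yx).
    have Mj := subgroupMz sM j Mn; rewrite pair_mulrz -mulrzA in Mj.
    have [|s sE] := kM (v - un *~ j).
      have := subgroupB sM Mp Mj; congr (M (_, _)).
      by rewrite /= (eqP yx) -mulrNz ij [n * j]mulrC subrr.
    exists (s - j * t); move: sE wE.
    have -> : w *~ i = - (j%:~R * (n%:~R * w)).
      by rewrite -mulrzl -[i]opprK ij rmorphN rmorphM /=; ring.
    rewrite -mulrzl => sE /eqP; rewrite subr_eq => /eqP->.
    rewrite !rmorphM rmorphB !rmorphM /= in sE *.
    by transitivity (v - j%:~R * un - j%:~R * (q%:~R * t%:~R)); [ring|rewrite sE; ring].
- by move=> p Mp; exists p, 0; rewrite mulr0z addr0.
- by exists 0, 1; rewrite mulr1z add0r; split=> //; case: sM.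
Qed.

Lemma local_graph_total M : local_graph M ->
  exists N, [/\ local_graph N, M `<=` N & forall x, exists u, N (x, u)].
Proof.
move=> gM.
have [F FP totF|A [gA maxA]] := @Zorn_bigcup _ (fun X => local_graph (M `|` X)).
  exact: local_graph_bigcup.
exists (M `|` A); split=> // x.
have [N [u [gN sN Nx]]] := local_graph_extend x gA.
exists u; right; apply: contrapT => nA; apply: (maxA N).
  split; first by move=> p Ap; apply: sN; right.
  by move=> /(_ _ Nx).
by have -> : M `|` N = N by apply/setUidPr => p Mp; apply: sN; left.
Qed.

(** The prescribed values are consistent: in a relation among [b] and the [z i], all terms but those
    of highest index [m] lie in the pure subgroup [Hs m], which omits [z m], so the total
    coefficient of [z m] is zero. *)
Lemma local_graph_generated d (I : orderType d) (L : set I) (Hs : I -> set G)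
    (z : I -> G) (b : G) (c : I -> nat) :
  (forall i, L i -> [/\ pure_subgroup (Hs i), Hs i b & ~ Hs i (z i)]) ->
  (forall i j, L i -> L j -> (i < j)%O -> Hs j (z i)) ->
  exists M, [/\ local_graph M, M (b, 0), M (0, q%:R)
    & forall i, L i -> M (z i, (q%:R ^+ c i)^-1)].
Proof.
move=> HsP zH.
pose zs (s : seq (int * I)) := \sum_(p <- s) z p.2 *~ p.1.
pose us (s : seq (int * I)) : rat := \sum_(p <- s) p.1%:~R / q%:R ^+ c p.2.
pose M : set (G * rat) := [set p | exists (j i : int) s,
  (forall t, t \in s -> L t.2) /\ p = (b *~ j + zs s, (q%:Z * i)%:~R + us s)].
have us0 j s : (forall t, t \in s -> L t.2) -> b *~ j + zs s = 0 -> us s = 0.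
  have [n] := ubnP (size s); elim: n s => // n IH [|p0 s] sn sL bz.
    by rewrite /us big_nil.
  have [[k m] ms mmax] := seq_max_image snd p0 s; rewrite /= in mmax.
  set t := p0 :: s in sn sL bz ms mmax *; clearbody t.
  pose t1 := [seq p <- t | p.2 == m]; pose t2 := [seq p <- t | p.2 != m].
  have zE : zs t = zs t1 + zs t2 by rewrite /zs (bigID (fun p => p.2 == m)) /= !big_filter.
  have uE : us t = us t1 + us t2 by rewrite /us (bigID (fun p => p.2 == m)) /= !big_filter.
  have Lm : L m by exact: (sL _ ms).
  have [pHm Hb nHz] := HsP m Lm; have [sHm _] := pHm.
  pose K := \sum_(p <- t1) p.1.
  have z1 : zs t1 = z m *~ K.
    rewrite /zs mulrz_sumr; apply: eq_big_seq => p.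
    by rewrite mem_filter => /andP[/eqP-> _].
  have u1 : us t1 = K%:~R / q%:R ^+ c m.
    rewrite /us rmorph_sum /= mulr_suml; apply: eq_big_seq => p.
    by rewrite mem_filter => /andP[/eqP-> _].
  have low : Hs m (zs t2).
    rewrite /zs big_seq; apply: subgroup_sum => // p.
    rewrite mem_filter => /andP[pm pt]; apply: subgroupMz => //.
    by apply: zH (sL _ pt) Lm _; rewrite lt_neqAle pm mmax.
  have K0 : K = 0.
    apply: contrapT => /eqP K0; apply/nHz/(pure_subgroupMz pHm K0).
    rewrite -z1; have -> : zs t1 = - (b *~ j + zs t2).
      by apply/eqP; rewrite -addr_eq0 addrCA -zE bz.
    by apply: subgroupN => //; apply: subgroupD => //; exact: subgroupMz.
  rewrite uE u1 K0 mul0r add0r; apply: IH.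
  - rewrite -ltnS; apply: leq_trans sn; rewrite ltnS size_filter.
    rewrite -(count_predC (fun p => p.2 == m) t) -add1n leq_add2r -has_count.
    by apply/hasP; exists (k, m) => /=.
  - by move=> p; rewrite mem_filter => /andP[_ /sL].
  - by move: bz; rewrite zE z1 K0 mulr0z add0r.
have zs0 : zs [::] = 0 by rewrite /zs big_nil.
have us00 : us [::] = 0 by rewrite /us big_nil.
exists M; split; [split; [split|..]|..].
- by exists 0, 0, [::]; split=> //; rewrite zs0 us00 mulr0 mulr0z !addr0.
- move=> _ _ [j [i [s [sL ->]]]] [j' [i' [s' [s'L ->]]]].
  exists (j - j'), (i - i'), (s ++ [seq (- p.1, p.2) | p <- s']); split.
    by move=> p; rewrite mem_cat => /orP[/sL//|/mapP[p' /s'L ? ->]].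
  rewrite /zs /us !big_cat !big_map /=.
  under [X in (_ + (_ + X), _)]eq_bigr => p _ do rewrite mulrNz.
  under [X in (_, _ + (_ + X))]eq_bigr => p _ do rewrite rmorphN mulNr.
  rewrite !sumrN mulrzBr mulrBr rmorphB /=.
  by congr (_, _) => /=; rewrite opprD addrACA.
- move=> _ [j [i [s [sL ->]]]] /=; apply: ZlocD; first exact: Zloc_int.
  apply: Zloc_sum => p _; exists (c p.2), p.1; rewrite divfK // expf_neq0 //.
  by rewrite pnatr_eq0 -lt0n prime_gt0.
- move=> u [j [i [s [sL [/esym bz ->]]]]]; exists i.
  by rewrite (us0 j s) ?addr0.
- by exists 1, 0, [::]; split=> //; rewrite zs0 us00 mulr0 mulr1z !addr0.
- by exists 0, 1, [::]; split=> //; rewrite zs0 us00 mulr1 mulr0z !addr0.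
- move=> i Li; exists 0, 0, [:: (1, i)]; split.
    by move=> p; rewrite inE => /eqP->.
  by rewrite /zs /us !big_seq1 /= mulr0z mulr0 mulr1z mul1r !add0r.
Qed.

End LocalCharacter.

(** On the subgroup [A] the character agrees with [phi] modulo [q], and the multiples of [b] in [A]
    are those of [d], that is [q] times [b]. So [d] splits off from [A] with a complement [D], and
    [h] is to kill [b] and agree with [phi] on [D]. *)
Lemma character_lift (G : zmodType) (q : nat) (M : set (G * rat)) (b : G)
    (phi : {additive G -> int}) :
  hereditarily_separable G -> prime q -> local_graph q M ->
  (forall x, exists u, M (x, u)) -> M (b, 0) -> M (0, q%:R) -> phi b = 1 ->
  exists h : {additive G -> rat}, (forall x, Zloc q (h x)) /\
    forall x n, M (x, (q%:R ^+ n)^-1) ->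
      exists j : int, h x * q%:R ^+ n = (1 - q%:Z * j)%:~R.
Proof.
move=> hs pq [sM ZM kM] totM Mb Mq phib.
have tf := hereditarily_separable_torsion_free hs.
have q0 : q%:R != 0 :> rat by rewrite pnatr_eq0 -lt0n prime_gt0.
have qz0 : q%:Z != 0 by rewrite eqz_nat -lt0n prime_gt0.
have b0 k : b *~ k = 0 -> k = 0.
  by move=> /(congr1 phi); rewrite raddfMz phib raddf0 mulrzz mul1r.
have Mbk (k : int) : M (b *~ k, 0).
  by have := subgroupMz sM k Mb; rewrite pair_mulrz mul0rz.
pose A := [set x | M (x, (phi x)%:~R)].
have sA : subgroup A.
  split; first by rewrite /A /= raddf0; case: sM.
  by move=> x y Ax Ay; rewrite /A /= raddfB rmorphB; exact: (subgroupB sM Ax Ay).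
pose d := b *~ q%:Z.
have Ad : A d.
  rewrite /A /= raddfMz phib mulrzz mul1r -pmulrn.
  by have := subgroupD sM (Mbk q%:Z) Mq; congr (M (_, _)); rewrite /= ?addr0 ?add0r.
have [D [sD DA dec Dd]] : exists D, [/\ subgroup D, D `<=` A,
    forall g, A g -> exists (k : int) y, D y /\ g = d *~ k + y &
    forall k : int, D (d *~ k) -> d *~ k = 0].
  apply: (cyclic_summand hs) => // m g k m0 Ag gk.
  have gE : g = b *~ phi g.
    apply/eqP; rewrite -subr_eq0; apply/eqP/(tf m) => //.
    have := congr1 phi gk; rewrite raddfMn /d -mulrzA raddfMz phib mulrzz mul1r => E.
    by rewrite mulrnBl gk [_ *+ m]pmulrn /d -!mulrzA -E -mulr_natr natz subrr.
  have [t tE] : exists t : int, (phi g)%:~R = (q%:Z * t)%:~R :> rat.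
    apply: kM; have := subgroupB sM Ag (Mbk (phi g)).
    by congr (M (_, _)); rewrite /= ?subr0 // -gE subrr.
  by exists t; rewrite {1}gE (intr_inj tE) mulrzA.
(* The graph of [h]: a power of [q] moves [x] into the sum of [D] and the multiples of [b]. *)
pose R x (u : rat) := exists k (n : int) y, [/\ D y, x *~ (q%:Z ^+ k) = b *~ n + y
  & u * q%:R ^+ k = (phi y)%:~R].
have lift x u k (U : int) : M (x, u) -> u * q%:R ^+ k = U%:~R ->
    exists j : int, R x ((U - q%:Z * j)%:~R / q%:R ^+ k).
  (* The multiple of [b] changes [phi] to [U] without changing the character, which puts [x'] into
     [A]. *)
  move=> Mx uU; pose x' := x *~ (q%:Z ^+ k) + b *~ (U - phi (x *~ (q%:Z ^+ k))).
  have phix' : phi x' = U by rewrite raddfD /= [phi (b *~ _)]raddfMz phib mulrzz mul1r addrC subrK.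
  have Ax' : A x'.
    rewrite /A /= phix'; have := subgroupD sM (subgroupMz sM (q%:Z ^+ k) Mx) (Mbk (U - phi (x *~ (q%:Z ^+ k)))).
    rewrite pair_mulrz; congr (M (_, _)) => /=.
    by rewrite addr0 -mulrzr rmorphXn /= -pmulrn uU.
  have [j [y [Dy x'E]]] := dec _ Ax'; exists j, k.
  exists (q%:Z * j - (U - phi (x *~ (q%:Z ^+ k)))), y; split=> //.
    rewrite mulrzBr [b *~ (q%:Z * j)]mulrzA -/d addrAC -x'E /x' addrK //.
  rewrite divfK ?expf_neq0 //; congr (_%:~R).
  have := congr1 phi x'E; rewrite phix' raddfD /= raddfMz /d raddfMz phib !mulrzz mul1r => ->.
  by rewrite addrAC subrr add0r.
have Rtot x : exists u, R x u.
  have [u Mu] := totM x; have [k [U uU]] := ZM _ Mu.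
  by have [j] := lift _ _ _ _ Mu uU; exists ((U - q%:Z * j)%:~R / q%:R ^+ k).
have RB x y u v : R x u -> R y v -> R (x - y) (u - v).
  move=> [k [n [x' [Dx' xE uE]]]] [l [m [y' [Dy' yE vE]]]].
  exists (k + l)%N, (n * q%:Z ^+ l - m * q%:Z ^+ k), (x' *~ q%:Z ^+ l - y' *~ q%:Z ^+ k); split.
  - by apply: subgroupB => //; exact: subgroupMz.
  - rewrite mulrzBl exprD [x *~ _]mulrzA xE [q%:Z ^+ k * _]mulrC mulrzA yE.
    by rewrite !mulrzDl mulrzBr !mulrzA opprD addrACA.
  - rewrite [phi _]raddfB ![phi (_ *~ _)]raddfMz !mulrzz rmorphB !rmorphM !rmorphXn /= -uE -vE exprD.
    by rewrite -!pmulrn; ring.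
have R0 u : R 0 u -> u = 0.
  move=> [k [n [y [Dy /esym yE uE]]]]; rewrite mul0rz in yE.
  have yn : y = b *~ (- n) by rewrite mulrNz; apply/eqP; rewrite -addr_eq0 addrC yE.
  have /Dd : D (d *~ (- n)).
    have := subgroupMz sD q%:Z Dy; rewrite yn /d -!mulrzA mulrC; exact.
  rewrite /d -mulrzA => /b0/eqP; rewrite mulf_eq0 (negbTE qz0) oppr_eq0 => /eqP n0.
  move: uE; rewrite yn n0 oppr0 mulr0z raddf0 => /eqP.
  by rewrite mulf_eq0 expf_eq0 (negbTE q0) andbF orbF => /eqP.
have Runiq x u v : R x u -> R x v -> u = v.
  move=> Ru Rv; apply/eqP; rewrite -subr_eq0; apply/eqP/R0.
  by have := RB _ _ _ _ Ru Rv; rewrite subrr.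
have /choice[h hP] := Rtot.
have hB : zmod_morphism h by move=> x y; apply: (Runiq (x - y)) => //; exact: RB.
pose h' : {additive G -> rat} := HB.pack h (GRing.isZmodMorphism.Build G rat h hB).
exists h'; split=> [x|x n Mx].
  by have [k [n [y [_ _ uE]]]] := hP x; exists k, (phi y).
have [|j Rj] := lift _ _ n 1 Mx; first by rewrite mulVf ?expf_neq0.
by exists j; have -> : h' x = _ := Runiq _ _ _ (hP x) Rj; rewrite divfK ?expf_neq0.
Qed.

(** * Ladders and guessing *)

Lemma le_iter_osucc a n : (a <= iter n osucc a)%O.
Proof. by elim: n => //= n IH; exact: le_trans IH (ltW (lt_osucc _)). Qed.

(** The [n]-th successor of a limit [a] codes the [n]-th element of [D a]. An element of [D d]
    appears below [d], so it is coded after every later limit, and these limits are cofinal in [d]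
    if [d] is closed under [F]. *)
Lemma unbounded_coding (X : Type) (D : omega1 -> set X) :
  (forall a, countable (D a)) -> (forall a, D a !=set0) ->
  (forall a b, (a <= b)%O -> D a `<=` D b) ->
  (forall d x, limit d -> D d x -> exists2 a, (a < d)%O & D a x) ->
  exists (rho : omega1 -> X) (F : omega1 -> omega1), forall d, closed_points F d ->
    forall x, D d x -> forall a, (a < d)%O -> exists y, (a < y < d)%O /\ rho y = x.
Proof.
move=> cD D0 Dle Dlim.
have /choice[en enP] : forall a, exists e : nat -> X, forall x, D a x -> exists n, e n = x.
  move=> a; have [x0 Dx0] := D0 a; have [e [_ eP]] := countable_enum Dx0 (cD a).
  by exists e.
have /choice[rho rhoP] : forall y, exists x, forall a n, limit a -> y = iter n osucc a ->
    x = en a n.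
  move=> y; have [[a [n [la yE]]]|no] := pselect (exists a n, limit a /\ y = iter n osucc a).
    exists (en a n) => a' n' la' yE'.
    by have [-> ->] := limit_iter_osucc_inj la la' (etrans (esym yE) yE').
  have [x _] := D0 y; exists x => a n la yE; case: no; by exists a, n.
have /choice[F FP] : forall a, exists l, limit l /\ (a < l)%O.
  by move=> a; have [l [ll _] al] := closed_points_above id a; exists l.
exists rho, F => d [ld Fd] x Dx a ad.
have [a' a'd Dx'] := Dlim _ _ ld Dx.
pose m := Order.max a a'.
have md : (m < d)%O by rewrite gt_max ad a'd.
have [ll ml] := FP m.
have [n enn] : exists n, en (F m) n = x.
  by apply: enP; apply: Dle Dx'; apply: le_trans (ltW ml); rewrite le_max lexx orbT.
exists (iter n osucc (F m)); split; last by rewrite (rhoP _ (F m) n).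
rewrite limit_iter_osucc ?Fd // andbT.
by apply: lt_le_trans (le_iter_osucc _ _); apply: le_lt_trans ml; rewrite le_max lexx.
Qed.

Lemma ladder_through (X : Type) (rho : omega1 -> X) d (s : nat -> X) : limit d ->
  (forall n a, (a < d)%O -> exists y, (a < y < d)%O /\ rho y = s n) ->
  exists e, ladder d e /\ forall n, rho (e n) = s n.
Proof.
move=> [[a0 a0d] ld] cof.
have [g [gd gP]] := countable_enum (K := [set y | (y < d)%O]) a0d (omega1_initial_countable d).
have /choice[pick pickP] : forall p : nat * omega1, exists y, (p.2 < d)%O ->
    (p.2 < y < d)%O /\ rho y = s p.1.
  move=> [n a]; have [/= ad|nad] := boolP (a < d)%O; last by exists a0.
  by have [y yP] := cof n a ad; exists y.
(* Each rung exceeds the previous one and the next term of an enumeration of the ordinals below [d],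
   which gives cofinality. *)
pose e := fix e n := if n is m.+1 then pick (n, Order.max (e m) (g n)) else pick (0%N, g 0%N).
have ed n : (e n < d)%O.
  elim: n => [|n IH].
    by have [/andP[]] := pickP (0%N, g 0%N) (gd 0%N).
  have [|/andP[]//] := pickP (n.+1, Order.max (e n) (g n.+1)).
  by rewrite /= gt_max IH gd.
have eS n : (Order.max (e n) (g n.+1) < e n.+1)%O.
  have [|/andP[]//] := pickP (n.+1, Order.max (e n) (g n.+1)).
  by rewrite /= gt_max ed gd.
have ge n : (g n < e n)%O.
  case: n => [|n]; first by have [/andP[]] := pickP (0%N, g 0%N) (gd 0%N).
  by have := eS n; rewrite gt_max => /andP[].
have e_lt n : (e n < e n.+1)%O by have := eS n; rewrite gt_max => /andP[].
exists e; split; last first.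
  case=> [|n]; first by have [] := pickP (0%N, g 0%N) (gd 0%N).
  have [|_ //] := pickP (n.+1, Order.max (e n) (g n.+1)).
  by rewrite /= gt_max ed gd.
split=> // [m n mn|a /gP[n <-]]; last by exists n; exact: ltW.
elim: n mn => // n IH; rewrite ltnS leq_eqVlt => /orP[/eqP->//|/IH mn].
exact: lt_trans mn (e_lt n).
Qed.

(** * Recovering a value of a homomorphism from finite lists of relations *)

Section Guessing.
Variables (G : zmodType) (q : nat).
Implicit Types (h : {additive G -> rat}) (e : nat -> G).

(* (m, c, a) stands for the assertion that sum_i c_i e_i + a is divisible by m. *)
Definition relation : Type := nat * seq int * G.
(* Finite information on a finite rank extension: the number r of generators e_i,
   the coordinates of the element to be evaluated, and a list of relations. *)
Definition datum : Type := nat * seq int * seq relation.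

Definition datum_over (K : set G) (D : datum) := forall t, List.In t D.2 -> K t.2.

Definition consistent_with h r (v : nat -> rat) (t : relation) :=
  Zloc q ((dot r (nth 0 t.1.2) v + h t.2) / t.1.1%:R).

(** An enumeration of all finite tuples of rationals, padded with zeros. *)
Definition candidate (k : nat) : nat -> rat := nth 0 (odflt [::] (unpickle k)).

Definition consistent h (D : datum) k := (forall i, Zloc q (candidate k i)) /\
  forall t, List.In t D.2 -> consistent_with h D.1.1 (candidate k) t.

(** For fixed [h] this depends on the datum alone and not on the ordinal whose ladder carries it, so
    ladders may share rungs. *)
Definition guess h (D : datum) : rat :=
  dot D.1.1 (nth 0 D.1.2) (candidate (xget 0%N
    [set k | consistent h D k /\ forall l, consistent h D l -> (k <= l)%N])).

Lemma countable_datum_over (K : set G) : countable K -> K 0 -> countable (datum_over K).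
Proof.
move=> cK K0; have [e [_ eK]] := countable_enum K0 cK.
pose dec (s : seq (nat * seq int * nat)) : seq relation := [seq (t.1, e t.2) | t <- s].
pose g (p : nat * seq int * seq (nat * seq int * nat)) : datum := (p.1, dec p.2).
apply: sub_countable (subset_card_le _) (countable_image g (countableP setT)).
move=> [p s] /= sK; suff [s' ss'] : exists s', dec s' = s.
  by exists (p, s') => //; rewrite /g /= ss'.
elim: s sK => [|[mc a] s IH] sK; first by exists [::].
have [|s' <-] := IH; first by move=> t ts; apply: sK; right.
have [|n <-] := eK a; first by apply: (sK (mc, a)); left.
by exists ((mc, n) :: s').
Qed.

Lemma In_mkseq (T : Type) (f : nat -> T) n t :
  List.In t (mkseq f n) <-> exists2 i, (i < n)%N & f i = t.
Proof.
elim: n => [|n IH]; first by split=> [[]|[]].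
rewrite /mkseq -addn1 iotaD map_cat add0n /= List.in_app_iff -/(mkseq f n) IH /=.
split=> [[[i i_n <-]|[<-|[]]]|[i]].
- by exists i => //; rewrite addn1 ltnS ltnW.
- by exists n; rewrite ?addn1.
- rewrite addn1 ltnS leq_eqVlt => /orP[/eqP->|i_n] <-; [by right; left|by left; exists i].
Qed.

Lemma dot_mkseq r c v : dot r (nth 0 (mkseq c r)) v = dot r c v.
Proof. by apply: eq_bigr => i _; rewrite nth_mkseq. Qed.

Lemma additive_lc h e r c : h (lc e r c) = dot r c (fun i => h (e i)).
Proof.
rewrite /lc raddf_sum; apply: eq_bigr => i _.
by rewrite raddfMz mulrzl.
Qed.

(** Let [k] be the least candidate consistent with all relations. Each smaller one is refuted at a
    finite stage, after which the guess uses [k]. The difference between [k] and the true tuple [k0]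
    is a homomorphism vanishing on [H], which [sep] makes zero at [c0]. *)
Lemma guess_eventually (H : set G) e r c0 h (rel : nat -> relation) :
  (forall v, hom_values q H e r v -> dot r c0 v = 0) ->
  (forall x, Zloc q (h x)) ->
  (forall n, exists2 x, (0 < (rel n).1.1)%N &
     x *+ (rel n).1.1 = lc e r (nth 0 (rel n).1.2) + (rel n).2) ->
  (forall m x c, (0 < m)%N -> H (x *+ m - lc e r c) ->
     exists n, rel n = (m, mkseq c r, x *+ m - lc e r c)) ->
  exists N, forall n, (N <= n)%N ->
    guess h (r, mkseq c0 r, mkseq rel n) = h (lc e r c0).
Proof.
move=> sep Zh relP relE.
pose D n : datum := (r, mkseq c0 r, mkseq rel n).
pose k0 := pickle (mkseq (fun i => h (e i)) r).
have k0E i : (i < r)%N -> candidate k0 i = h (e i).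
  by move=> ir; rewrite /candidate pickleK /= nth_mkseq.
have dotk0 c : dot r c (candidate k0) = h (lc e r c).
  by rewrite additive_lc; apply: eq_bigr => i _; rewrite k0E.
have k0P n : consistent h (D n) k0.
  split=> [i|t /In_mkseq[i _ <-]].
    have [ir|ri] := ltnP i r; first by rewrite k0E.
    by rewrite /candidate pickleK /= nth_default ?size_mkseq //; exact: (Zloc_int q 0).
  have [x m0 xE] := relP i; rewrite /consistent_with dotk0 -raddfD -xE raddfMn.
  by rewrite -[h x *+ _]mulr_natr mulfK // pnatr_eq0 -lt0n.
have exk : exists k, `[< forall n, consistent h (D n) k >] by exists k0; apply/asboolP.
case: (ex_minnP exk) => k /asboolP kP kmin.
have /choice[N NP] : forall l, exists n, (l < k)%N -> ~ consistent h (D n) l.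
  move=> l; have [lk|kl] := ltnP l k; last by exists 0%N.
  have /existsNP[n nP] : ~ forall n, consistent h (D n) l.
    by move=> /asboolP/kmin; rewrite leqNgt lk.
  by exists n.
exists (\max_(l < k) N l)%N => n Nn; rewrite /guess /= dot_mkseq.
case: xgetP => [l _ [lP lmin]|none]; last first.
  case: (none k); split=> [|l lP]; first exact: kP.
  rewrite leqNgt; apply/negP => lk.
  apply: (NP l lk); split; first by case: lP.
  move=> t /In_mkseq[i iN tE]; apply: lP.2; apply/In_mkseq; exists i => //.
  by apply: leq_trans iN (leq_trans (leq_bigmax (Ordinal lk)) Nn).
have -> : l = k.
  apply/eqP; rewrite eqn_leq (lmin _ (kP n)) leqNgt; apply/negP => lk.
  apply: (NP l lk); split; first by case: lP.
  move=> t /In_mkseq[i iN tE]; apply: lP.2; apply/In_mkseq; exists i => //.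
  by apply: leq_trans iN (leq_trans (leq_bigmax (Ordinal lk)) Nn).
apply/eqP; rewrite -subr_eq0 -dotk0 -dotBr; apply/eqP/sep; split=> [i|m x c m0 Hx].
  by apply: ZlocB; [case: (kP 0%N)|case: (k0P 0%N)].
have [i relEi] := relE _ _ _ m0 Hx.
have irel : List.In (rel i) (mkseq rel i.+1) by apply/In_mkseq; exists i.
have cons k1 : (forall n, consistent h (D n) k1) ->
    Zloc q ((dot r c (candidate k1) + h (x *+ m - lc e r c)) / m%:R).
  by move=> /(_ i.+1)[_ /(_ _ irel)]; rewrite /consistent_with relEi /= dot_mkseq.
have := ZlocB (cons k kP) (cons k0 k0P).
by rewrite -mulrBl opprD addrACA subrr addr0 dotBr.
Qed.

(** Minus the [q]-adic valuation, on rationals of the form that [character_lift] produces. *)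
Definition color (u : rat) : nat :=
  xget 0%N [set c | exists j : int, u * q%:R ^+ c = (1 - q%:Z * j)%:~R].

Lemma colorE u c (j : int) : prime q ->
  u * q%:R ^+ c = (1 - q%:Z * j)%:~R -> color u = c.
Proof.
move=> pq uc; have uniq_le a a' (i i' : int) : u * q%:R ^+ a = (1 - q%:Z * i)%:~R ->
    u * q%:R ^+ a' = (1 - q%:Z * i')%:~R -> (a' <= a)%N.
  move=> ua ua'; rewrite leqNgt; apply/negP => aa'.
  have E : 1 - q%:Z * i' = (1 - q%:Z * i) * q%:Z ^+ (a' - a).
    apply: (@intr_inj rat); rewrite -ua' [RHS]rmorphM /= -ua rmorphXn /= -pmulrn.
    by rewrite -mulrA -exprD subnKC // ltnW.
  have : (q%:Z %| (1%R : int))%Z.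
    rewrite -[X in (_ %| X)%Z](subrK (q%:Z * i')) E; apply: rpredD; last exact: dvdz_mulr.
    by apply: dvdz_mull; rewrite -(subnSK aa') exprS; exact: dvdz_mulr.
  by rewrite dvdz1 /= => /eqP q1; rewrite q1 in pq.
rewrite /color; case: xgetP => [c' _ [j' uc']|/(_ c)]; last by case; exists j.
by apply/eqP; rewrite eqn_leq (uniq_le _ _ _ _ uc uc') (uniq_le _ _ _ _ uc' uc).
Qed.

End Guessing.

(** * The ladder system *)

Section Main.
Variables (G : zmodType) (idx : G -> omega1).
Hypotheses (idx_inj : injective idx) (hs : hereditarily_separable G).
Hypothesis not_free : ~ free_abelian (@predT G).

Lemma closed_points_max (F1 F2 : omega1 -> omega1) d :
  closed_points (fun a => Order.max (F1 a) (F2 a)) d ->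
  closed_points F1 d /\ closed_points F2 d.
Proof.
move=> [ld Fd]; split; split=> // a /Fd; rewrite gt_max => /andP[] //.
Qed.

(** If this failed for 2 and for 3, intersecting the clubs that witness it would leave a club to
    which [free_of_separated_club] applies. *)
Lemma stationary_unseparated F : exists q, prime q /\
  stationary [set d | closed_points F d /\ unseparated q (initial idx d)].
Proof.
have tf := hereditarily_separable_torsion_free hs.
have [Fp pureP] := initial_pure_club idx_inj tf.
apply: contrapT => nst.
have nstq q : prime q -> exists Fq, forall d, closed_points F d ->
    unseparated q (initial idx d) -> ~ closed_points Fq d.
  move=> pq; have [|Fq FqP] := @not_stationary_closed_points
      [set d | closed_points F d /\ unseparated q (initial idx d)].
    by move=> st; apply: nst; exists q.
  by exists Fq => d Fd ud; exact: FqP.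
have [F2 F2P] := nstq 2%N isT; have [F3 F3P] := nstq 3%N isT.
pose F' := fun a => Order.max (Order.max (F a) (Fp a)) (Order.max (F2 a) (F3 a)).
apply/not_free/(free_of_separated_club idx_inj (F := F')) => //.
  by move=> q _; exact: not_unseparated0.
move=> d /closed_points_max[/closed_points_max[Fd Fpd] /closed_points_max[F2d F3d]].
split; first exact: pureP.
move=> q; rewrite !inE => /orP[]/eqP-> ud; first exact: (F2P d).
exact: (F3P d).
Qed.

Lemma nonzero_of_not_free : exists z : G, z <> 0.
Proof.
apply: contrapT => /forallNP/(_ _)/contrapT all0; apply: not_free.
apply: (@free_abelian_of_basis _ set0) => [s a _ s0 _ x /s0 //|x].
by apply: sub_generatedl; exact: all0.
Qed.

Lemma monochromatic_ladder_system : exists (S : set omega1) (eta : omega1 -> nat -> omega1),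
  [/\ stationary S, ladder_system S eta & monochromatic_uniformization S eta].
Proof.
have tf := hereditarily_separable_torsion_free hs.
have [Fp pureP] := initial_pure_club idx_inj tf.
have [z0 /(coordinate_exists hs)[b [phi [_ [phib _]]]]] := nonzero_of_not_free.
(* For p = (q, d): generators and rank of a finite rank extension of H_d, and
   coordinates of an element killed by all its homomorphisms into Z[1/q]. *)
have /choice[wit witP] : forall p : nat * omega1, exists w : (nat -> G) * nat * (nat -> int),
    unseparated p.1 (initial idx p.2) -> ~ initial idx p.2 (lc w.1.1 w.1.2 w.2) /\
    forall v, hom_values p.1 (initial idx p.2) w.1.1 w.1.2 v -> dot w.1.2 w.2 v = 0.
  move=> p; have [[e [r [c eP]]]|nu] := pselect (unseparated p.1 (initial idx p.2)).
    by exists (e, r, c).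
  by exists (fun=> 0, 0%N, fun=> 0).
pose z q d := lc (wit (q, d)).1.1 (wit (q, d)).1.2 (wit (q, d)).2.
have cI d := initial_countable idx_inj d.
have [||||rho [Fr rhoP]] := @unbounded_coding (datum G) (fun d => datum_over (initial idx d)).
- by move=> d; apply: countable_datum_over (cI d) _; left.
- by move=> d; exists (0%N, [::], [::]) => t [].
- by move=> a d ad [D s] Ds t /Ds; exact: initial_le.
- move=> d [D s] ld; rewrite /datum_over /=; elim: s => [|t s IH] sP.
    by have [[a ad] _] := ld; exists a => // t [].
  have [|a ad aP] := IH; first by move=> t' t's; apply: sP; right.
  have [a' a'd a'P] := initial_limit ld (sP t (or_introl erefl)).
  exists (Order.max a a'); first by rewrite gt_max ad a'd.
  move=> t' [<-|/aP]; first by apply: initial_le a'P; rewrite le_max lexx orbT.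
  by apply: initial_le; rewrite le_max lexx.
(* All [q] are bounded at once, since the prime is chosen only after the club. *)
have /choice[Fz FzP] : forall a, exists u, forall q : nat, (idx (z q a) < u)%O.
  move=> a; have [u uP] := countable_lt_bounded (countable_image (fun q => idx (z q a)) (countableP setT)).
  by exists u => q; apply: uP; exists q.
pose F := fun a => Order.max (Order.max (Fp a) (Fr a)) (Order.max (Fz a) (idx b)).
have [q [pq stS]] := stationary_unseparated F.
set S := [set d | _] in stS.
have SP d : S d -> [/\ limit d, pure_subgroup (initial idx d), initial idx d b,
    forall a, (a < d)%O -> initial idx d (z q a) & forall D, datum_over (initial idx d) D ->
      forall a, (a < d)%O -> exists y, (a < y < d)%O /\ rho y = D].
  move=> [/closed_points_max[/closed_points_max[Fpd Frd] /closed_points_max[Fzd [ld bd]]] _].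
  split=> //.
  - exact: pureP.
  - by right; have [[a ad] _] := ld; exact: bd ad.
  - by move=> a ad; right; apply: lt_trans (FzP a q) _; case: Fzd => _; exact.
  - by move=> D DP a ad; exact: (rhoP _ Frd _ DP _ ad).
pose e d := (wit (q, d)).1.1; pose r d := (wit (q, d)).1.2; pose c0 d := (wit (q, d)).2.
have /choice[rel relP] : forall d, exists rel : nat -> relation G, S d ->
    [/\ forall n, initial idx d (rel n).2,
     forall n, exists2 x, (0 < (rel n).1.1)%N &
       x *+ (rel n).1.1 = lc (e d) (r d) (nth 0 (rel n).1.2) + (rel n).2
     & forall m x c, (0 < m)%N -> initial idx d (x *+ m - lc (e d) (r d) c) ->
       exists n, rel n = (m, mkseq c (r d), x *+ m - lc (e d) (r d) c)].
  move=> d; have [Sd|nS] := pselect (S d); last by exists (fun=> (0%N, [::], 0)).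
  (* All true divisibility relations with constant term in H_d; [rel] enumerates them. *)
  pose K := [set t : relation G | initial idx d t.2 /\
    exists2 x, (0 < t.1.1)%N & x *+ t.1.1 = lc (e d) (r d) (nth 0 t.1.2) + t.2].
  have cK : countable K.
    apply: sub_countable (subset_card_le _) (countableX (countableP setT) (cI d)).
    by move=> [t a] [].
  have K0 : K (1%N, [::], 0).
    split; [by left|exists 0] => //=.
    by rewrite mul0rn addr0 /lc big1 // => i _; rewrite nth_nil.
  have [rel [Krel relK]] := countable_enum K0 cK.
  exists rel => _; split=> [n|n|m x c m0 Hx]; [by case: (Krel n)|by case: (Krel n)|].
  apply: relK; split=> //=; exists x => //.
  rewrite addrC; have -> : lc (e d) (r d) (nth 0 (mkseq c (r d))) = lc (e d) (r d) c.
    by apply: eq_bigr => i _; rewrite nth_mkseq.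
  by rewrite subrK.
pose dat d n : datum G := (r d, mkseq (c0 d) (r d), mkseq (rel d) n).
have /choice[eta etaP] : forall d, exists eta, S d -> ladder d eta /\ forall n, rho (eta n) = dat d n.
  move=> d; have [Sd|nS] := pselect (S d); last by exists (fun=> d).
  have [ld _ _ _ cofd] := SP d Sd; have [relI _ _] := relP d Sd.
  have [|eta etaP] := @ladder_through _ rho d (dat d) ld; last by exists eta.
  move=> n a ad; apply: cofd => // t /In_mkseq[i _ <-]; exact: relI.
exists S, eta; split=> //.
  by split=> [d /SP[]//|d /etaP[]].
(* The ladders are fixed by now; only [h], and with it the uniformizing function, depends on the
   colouring. *)
move=> c.
have [||M0 [gM0 M0b M0q M0z]] := @local_graph_generated G q pq _ _ S (initial idx) (z q) b c.
- move=> d Sd; have [_ pd bd _ _] := SP d Sd; split=> //.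
  by have [_ /(witP (q, d))[]] := Sd.
- by move=> a d _ Sd ad; have [_ _ _ zd _] := SP d Sd; exact: zd.
have [M [gM sM totM]] := local_graph_total pq gM0.
have [h [Zh hP]] := character_lift hs pq gM totM (sM _ M0b) (sM _ M0q) phib.
have /choice[fstar fP] : forall d, exists N, S d -> forall n, (N <= n)%N ->
    guess q h (dat d n) = h (z q d).
  move=> d; have [Sd|nS] := pselect (S d); last by exists 0%N.
  have [_ rel1 rel2] := relP d Sd; have [_ /(witP (q, d))[_ sep]] := Sd.
  have [N NP] := guess_eventually sep Zh rel1 rel2.
  by exists N.
exists (fun x => color q (guess q h (rho x))), fstar => d n Sd dn.
have [_ ->] := etaP d Sd; rewrite fP //.
have [j jE] := hP _ _ (sM _ (M0z d Sd)).
exact: colorE jE.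
Qed.

End Main.

Theorem theorem8 :
  (exists G : zmodType,
     [/\ ([set: G] #= [set: omega1])%card,
         hereditarily_separable G
       & ~ free_abelian (@predT G)]) ->
  exists (S : set omega1) (eta : omega1 -> nat -> omega1),
    [/\ stationary S, ladder_system S eta
      & monochromatic_uniformization S eta].
Proof.
move=> [G [cardG hs nf]].
have [idx idx_inj] : exists idx : G -> omega1, injective idx.
  move/card_eqPle: cardG => [/card_leP[f] _].
  exists (fun x => val (f (SigSub (mem_set (I : [set: G] x))))) => x y.
  by move=> /val_inj/(inj (in_setT _) (in_setT _))/(congr1 val).
exact: monochromatic_ladder_system idx_inj hs nf.
Qed.
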